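(* Let $F$ be a regular or singular nonlinearity, and for $\alpha>-2$ let $\lambda^*_\alpha(N)$ and $u^*_\alpha$ be the extremal parameter and extremal solution of $-\Delta u=\lambda|x|^\alpha F(u)$ in $B$, $u=0$ on $\partial B$, where $B$ is the unit ball of $\mathbb{R}^N$. 1. For any dimension $N\ge1$, as $\alpha\to\infty$, $$\lambda^*_\alpha(N)\sim\Big(1+\frac\alpha2\Big)^2\lambda^*_0(2).$$ 2. If $N=2$, then $$\lambda^*_\alpha(2)=\Big(1+\frac\alpha2\Big)^2\lambda^*_0(2)\quad\text{and}\quad\|u^*_\alpha\|_{L^\infty}=\|u^*_0\|_{L^\infty}\qquad\text{for all }\alpha>-2.$$
   Context: A nonlinearity $F$ is a smooth, increasing, convex function on its domain $D_F=[0,a_F)$ with $F(0)=1$; it is regular if $a_F=+\infty$ and $F$ is superlinear, and singular if $a_F=1$ and $\lim_{u\nearrow1}F(u)=+\infty$. A solution of $-\Delta u=\lambda|x|^\alpha F(u)$ in $B$, $u=0$ on $\partial B$, is classical if $\|u\|_{L^\infty}<\infty$ ($F$ regular), resp. $\|u\|_{L^\infty}<1$ ($F$ singular). The extremal parameter (pull-in voltage) $\lambda^*_\alpha(N)$ is the supremum of the $\lambda>0$ for which a classical solution exists; for $0<\lambda<\lambda^*_\alpha(N)$ there is a minimal classical solution $u_\lambda$, increasing in $\lambda$, and the extremal solution is $u^*_\alpha(x):=\lim_{\lambda\nearrow\lambda^*_\alpha(N)}u_\lambda(x)$. The case $\alpha=0$ is the constant profile $f\equiv1$. The symbol $\sim$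 means that the ratio of the two sides tends to $1$. *)

(* Defs.v *)
From HB Require Import structures.
From mathcomp Require Import all_boot all_order all_algebra.
From mathcomp Require Import all_classical all_reals all_analysis.

Set Implicit Arguments.
Unset Strict Implicit.
Unset Printing Implicit Defensive.
Import Order.TTheory GRing.Theory Num.Theory.
Import numFieldNormedType.Exports.

Local Open Scope classical_set_scope.
Local Open Scope ring_scope.

(* The domain [0, aF[ of a nonlinearity, with aF in \bar R.  Values of
   F : R -> R outside the domain play no role below. *)
Definition nl_domain (R : realType) (aF : \bar R) : set R :=
  [set t | 0 <= t /\ (t%:E < aF)%E].

(* Smoothness up to the closed endpoint 0: F is the restriction of a function
   that is infinitely differentiable on an open interval ]-e, aF[. *)
Definition smooth_on_domain (R : realType) (aF : \bar R) (F : R -> R) : Prop :=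
  exists (G : R -> R) (e : R),
    [/\ 0 < e,
        forall t, nl_domain aF t -> G t = F t &
        forall (n : nat) (t : R), - e < t -> (t%:E < aF)%E ->
          derivable (derive1n n G) t 1].

Definition nonlinearity (R : realType) (aF : \bar R) (F : R -> R) : Prop :=
  [/\ smooth_on_domain aF F,
      {in nl_domain aF &, {homo F : x y / x < y}},
      convex_function (nl_domain aF) F &
      F 0 = 1].

Definition regular_nonlinearity (R : realType) (aF : \bar R) (F : R -> R) :
    Prop :=
  [/\ nonlinearity aF F, aF = +oo%E & F t / t @[t --> +oo] --> +oo].

Definition singular_nonlinearity (R : realType) (aF : \bar R) (F : R -> R) :
    Prop :=
  [/\ nonlinearity aF F, aF = 1%:E & F t @[t --> 1^'-] --> +oo].

(* The norm of the library on 'rV[R]_N is the sup norm, hence this definition;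
   both norms induce the same topology. *)
Definition enorm (R : realType) (N : nat) (x : 'rV[R]_N) : R :=
  Num.sqrt (\sum_(i < N) x 0 i ^+ 2).

Definition unit_ball (R : realType) (N : nat) : set 'rV[R]_N :=
  [set x | enorm x < 1].
Arguments unit_ball {R} N _.

Definition unit_cball (R : realType) (N : nat) : set 'rV[R]_N :=
  [set x | enorm x <= 1].
Arguments unit_cball {R} N _.

Definition partial (R : realType) (N : nat) (i : 'I_N) (u : 'rV[R]_N -> R) :
    'rV[R]_N -> R :=
  'D_(delta_mx 0 i) u.

Definition laplacian (R : realType) (N : nat) (u : 'rV[R]_N -> R) :
    'rV[R]_N -> R :=
  fun x => \sum_(i < N) partial i (partial i u) x.

(* U is meant to be open. *)
Definition C1_on (R : realType) (N : nat) (U : set 'rV[R]_N)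
    (u : 'rV[R]_N -> R) : Prop :=
  forall (x : 'rV[R]_N) (i : 'I_N), U x ->
    derivable u x (delta_mx 0 i) /\ {for x, continuous (partial i u)}.

Definition C2_on (R : realType) (N : nat) (U : set 'rV[R]_N)
    (u : 'rV[R]_N -> R) : Prop :=
  C1_on U u /\ forall i : 'I_N, C1_on U (partial i u).

(* The part of the ball where the weight |x|^alpha is finite. *)
Definition weight_region (R : realType) (N : nat) (alpha : R) :
    set 'rV[R]_N :=
  if 0 <= alpha then unit_ball N else unit_ball N `\ 0.
Arguments weight_region {R} N alpha _.

(* u solves - Delta u = lambda |x|^alpha F(u) in the unit ball B of R^N and
   vanishes on the boundary.  Values of u outside the closed ball are ignored.
   For alpha >= 0 this is the pointwise notion, with u of class C^2 in B.  For
   alpha < 0 the weight is infinite at 0, and the equation is read pointwise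
   off the origin; no singular source can hide at 0, because u is continuous
   there if N >= 2 (a point is then removable) and of class C^1 there if
   N = 1. *)
Definition solution (R : realType) (aF : \bar R) (F : R -> R) (N : nat)
    (alpha lambda : R) (u : 'rV[R]_N -> R) : Prop :=
  [/\ {within unit_cball N, continuous u},
      C2_on (weight_region N alpha) u /\ (N = 1%N -> C1_on (unit_ball N) u),
      forall x, unit_ball N x -> nl_domain aF (u x),
      forall x, weight_region N alpha x ->
        - laplacian u x = lambda * enorm x `^ alpha * F (u x) &
      forall x, enorm x = 1 -> u x = 0].

(* The L^oo(B) norm as a pointwise supremum: the functions it is applied to
   are continuous in B, or (extremal solutions) nonnegative increasing limits
   of functions continuous in B, so that it equals the essential supremum. *)
Definition sup_norm (R : realType) (N : nat) (w : 'rV[R]_N -> \bar R) :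
    \bar R :=
  ereal_sup [set `|w x|%E | x in unit_ball N].

(* aF = +oo gives sup_norm u < +oo, and aF = 1 gives sup_norm u < 1. *)
Definition classical_solution (R : realType) (aF : \bar R) (F : R -> R)
    (N : nat) (alpha lambda : R) (u : 'rV[R]_N -> R) : Prop :=
  solution aF F alpha lambda u /\ (sup_norm (EFin \o u) < aF)%E.

(* The library's sup is 0 on an empty or unbounded set; a nonzero value is
   thus the genuine supremum. *)
Definition extremal_parameter (R : realType) (aF : \bar R) (F : R -> R)
    (N : nat) (alpha : R) : R :=
  sup [set lambda | 0 < lambda /\
        exists u : 'rV[R]_N -> R, classical_solution aF F alpha lambda u].
Arguments extremal_parameter {R} aF F N alpha.

Definition is_minimal_solution (R : realType) (aF : \bar R) (F : R -> R)
    (N : nat) (alpha lambda : R) (u : 'rV[R]_N -> R) : Prop :=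
  classical_solution aF F alpha lambda u /\
  forall v : 'rV[R]_N -> R, classical_solution aF F alpha lambda v ->
    forall x, unit_cball N x -> u x <= v x.

(* Unique on the closed ball when it exists. *)
Definition minimal_solution (R : realType) (aF : \bar R) (F : R -> R)
    (N : nat) (alpha lambda : R) : 'rV[R]_N -> R :=
  xget (fun=> 0) [set u | is_minimal_solution aF F alpha lambda u].
Arguments minimal_solution {R} aF F N alpha lambda _.

(* Valued in \bar R since the limit may be +oo at the origin. *)
Definition extremal_solution (R : realType) (aF : \bar R) (F : R -> R)
    (N : nat) (alpha : R) : 'rV[R]_N -> \bar R :=
  fun x => lim ((minimal_solution aF F N alpha lambda x)%:E
    @[lambda --> (extremal_parameter aF F N alpha)^'-]).
Arguments extremal_solution {R} aF F N alpha _.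

(* Main.v *)
Require Import Defs.
From mathcomp Require Import all_boot all_order all_algebra.
From mathcomp Require Import all_classical all_reals all_analysis.
From mathcomp Require Import ring lra.

Set Implicit Arguments.
Unset Strict Implicit.
Unset Printing Implicit Defensive.
Import Order.TTheory GRing.Theory Num.Theory.
Import numFieldNormedType.Exports.

Local Open Scope classical_set_scope.
Local Open Scope ring_scope.

(** Put p = 1 + alpha / 2. For radial functions, the substitution s = r ^ p
    turns the equation with weight |x| ^ alpha in dimension N and parameter
    lambda into the equation with constant weight, parameter lambda / p ^ 2 and
    fractional dimension 2 + (N - 2) / p. The dimension stays equal to 2 when
    N = 2, which gives the exact identities, and tends to 2 as alpha tends to
    infinity. What remains is to reduce to radial functions and to prove that
    the extremal parameter is continuous in the dimension at 2.

    Fractional dimensions are avoided: each problem is compared with the planar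
    one directly, and a solution of either problem provides a barrier for the
    other. The key is [fixpoint_below]: a radial solution exists below every
    barrier that is respected by the linear radial problem, for which existence
    and comparison are elementary ([radial_poisson_ex], [profile_comparison]).

    From dimension N to the plane, the barrier is an arbitrary classical
    solution w, which need not be radial. If N >= 2, the planar functions are
    transplanted to the ball by a change of variables g that maps fundamental
    solutions to each other: g = r ^ p if N = 2, and a flat exponential if
    N >= 3. The weight it produces exceeds p ^ 2 r ^ alpha by a factor at most
    exp(2 (N - 2) / p). Since a point is removable, the maximum principle may
    be applied off the origin ([planar_solution_below]). If N = 1, the barrier
    is the even part of w, a supersolution by convexity of F
    ([planar_solution_of_interval]). From the plane to dimension N, the barrier
    is a transplanted planar solution ([radial_solution_of_planar]): r ^ p is
    good enough if N >= 2, and an exponential change of variables, at the cost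
    of a factor exp(- 2 / p), if N = 1.

    Altogether, the extremal parameter divided by p ^ 2 times the planar one
    lies between exp(- 2 N / p) and exp(2 N / p)
    ([extremal_parameter_bounds]), and the asymptotics follow by squeezing,
    once the planar extremal parameter is known to be positive and finite
    ([planar_voltages_nonempty], [planar_voltages_bounded]).

    In the disc, every classical solution for the weight |x| ^ alpha lies above
    a radial one obtained from a planar solution by x |-> u(|x| ^ p). Hence the
    minimal solution is the image of the least planar solution
    ([minimal_solution_disc]), and so is the extremal solution; since r ^ p is
    a bijection of [0, 1), the suprema agree. *)

(** * Calculus on the line *)

Section ContinuousAt.
Context {R : realType} {T : topologicalType}.
Implicit Types (f g k c : T -> R) (t : T).

Lemma continuous_at_cst (b : R) t : {for t, continuous (fun=> b : R)}.
Proof. exact: cvg_cst. Qed.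

Lemma continuous_at_add f g t : {for t, continuous f} -> {for t, continuous g} ->
  {for t, continuous (fun s => f s + g s)}.
Proof. by move=> cf cg; apply: cvgD. Qed.

Lemma continuous_at_opp f t : {for t, continuous f} ->
  {for t, continuous (fun s => - f s)}.
Proof. by move=> cf; apply: cvgN. Qed.

Lemma continuous_at_sub f g t : {for t, continuous f} -> {for t, continuous g} ->
  {for t, continuous (fun s => f s - g s)}.
Proof. by move=> cf cg; apply: cvgB. Qed.

Lemma continuous_at_mul f g t : {for t, continuous f} -> {for t, continuous g} ->
  {for t, continuous (fun s => f s * g s)}.
Proof. by move=> cf cg; apply: cvgM. Qed.

Lemma continuous_at_inv f t : f t != 0 -> {for t, continuous f} ->
  {for t, continuous (fun s => (f s)^-1)}.
Proof. by move=> ft0 cf; apply: cvgV. Qed.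

Lemma continuous_at_mul_bounded f c t : {for t, continuous f} -> f t = 0 ->
  (forall s, `|c s| <= 1) -> {for t, continuous (fun s => f s * c s)}.
Proof.
move=> cf ft0 c1; rewrite /prop_for /continuous_at ft0 mul0r.
apply/cvgr0Pnorm_lt => e e0; have := cf; rewrite /prop_for /continuous_at ft0.
move=> /cvgr0Pnorm_lt/(_ _ e0); apply: filterS => s; apply: le_lt_trans.
by rewrite normrM ler_piMr.
Qed.

(** Used with k the Euclidean norm: a radial function is continuous at the
    origin as soon as its profile is continuous there from the right. *)
Lemma continuous_at_right0 (f : R -> R) k t :
  f r @[r --> 0^'+] --> f 0 -> k t = 0 -> (forall s, 0 <= k s) ->
  {for t, continuous k} -> {for t, continuous (fun s => f (k s))}.
Proof.
move=> /cvgrPdist_lt cf kt0 k0 ck; apply/cvgrPdist_lt => e e0; rewrite kt0.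
have := cf e e0; rewrite near_withinE -kt0 => /ck; rewrite nbhs_simpl/=.
apply: filterS => s; have := k0 s; rewrite le_eqVlt => /predU1P[<- _|ks].
  by rewrite kt0 subrr normr0.
by rewrite kt0; exact.
Qed.

Lemma near_eq_continuous {S : topologicalType} (f g : T -> S) t :
  (\near t, f t = g t) -> {for t, continuous f} -> {for t, continuous g}.
Proof.
move=> fg cf; rewrite /prop_for /continuous_at -(nbhs_singleton fg).
exact: cvg_trans (near_eq_cvg fg) cf.
Qed.

End ContinuousAt.

Section Calculus.
Context {R : realType}.
Implicit Types (f g df : R -> R) (a b c d x y : R).

Lemma is_derive_continuous {f x d} : is_derive x 1 f d -> {for x, continuous f}.
Proof.
by move=> [fx _]; exact/differentiable_continuous/derivable1_diffP.
Qed.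

Lemma is_derive_mul (V : normedModType R) (f g : V -> R) (x v : V) (a b : R) :
  is_derive x v f a -> is_derive x v g b ->
  is_derive x v (fun t => f t * g t) (a * g x + f x * b).
Proof.
move=> fa gb; apply: (is_derive_eq (is_deriveM fa gb)).
by rewrite addrC; congr (_ + _); rewrite /GRing.scale/= mulrC.
Qed.

Lemma is_derive_inv f x d : f x != 0 -> is_derive x 1 f d ->
  is_derive x 1 (fun t => (f t)^-1) (- (d / f x ^+ 2)).
Proof.
move=> fx0 fd; apply: (is_derive_eq (is_deriveV fx0 fd)).
by rewrite /GRing.scale/= mulNr mulrC.
Qed.

Lemma is_derive_pow n x : is_derive x 1 (fun t : R => t ^+ n) (n%:R * x ^+ n.-1).
Proof.
apply: DeriveDef; first exact: exprn_derivable.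
by rewrite exp_derive /GRing.scale/= mulr1.
Qed.

Lemma is_derive_scale c f x d :
  is_derive x 1 f d -> is_derive x 1 (fun t => c * f t) (c * d).
Proof.
move=> fd; have dc : is_derive x 1 (fun=> c) 0 by exact: is_derive_cst.
by apply: (is_derive_eq (is_derive_mul dc fd)); rewrite mul0r add0r.
Qed.

(** With its bounded variant below, the form in which the mean value theorem
    serves to compare radial functions: one integrates the sign of a
    derivative. *)
Lemma le_of_derive_ge0 f df a b : a <= b ->
  (forall x, a < x < b -> is_derive x 1 f (df x)) ->
  (forall x, a < x < b -> 0 <= df x) ->
  {within `[a, b], continuous f} -> f a <= f b.
Proof.
move=> ab fdf df0 cf.
move: ab; rewrite le_eqVlt => /predU1P[->//|].
move=> ltab; have fdf' x : x \in `]a, b[%R -> is_derive x 1 f (df x).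
  by rewrite in_itv; exact: fdf.
have [c cab fE] := MVT ltab fdf' cf.
rewrite -subr_ge0 fE; apply: mulr_ge0; last by rewrite subr_ge0 ltW.
apply: df0.
by move: cab; rewrite in_itv.
Qed.

Lemma norm_sub_le_of_derive f df a b K : a <= b ->
  (forall x, a < x < b -> is_derive x 1 f (df x)) ->
  (forall x, a < x < b -> `|df x| <= K) ->
  {within `[a, b], continuous f} -> `|f b - f a| <= K * (b - a).
Proof.
rewrite le_eqVlt => /predU1P[-> _ _ _|ab fdf dfK cf].
  by rewrite !subrr normr0 mulr0.
have fdf' x : x \in `]a, b[%R -> is_derive x 1 f (df x).
  by rewrite in_itv; exact: fdf.
have [c cab ->] := MVT ab fdf' cf.
rewrite normrM (gtr0_norm (_ : 0 < b - a)) ?subr_gt0// ler_wpM2r ?subr_ge0 ?(ltW ab)//.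
by apply: dfK; move: cab; rewrite in_itv.
Qed.

Lemma within_of_derive f df a b :
  (forall x, a <= x <= b -> is_derive x 1 f (df x)) ->
  {within `[a, b], continuous f}.
Proof.
move=> fdf; apply: derivable_within_continuous => x.
by rewrite in_itv/= => /fdf[].
Qed.

Lemma is_derive_id_mul0 (m : R -> R) : {for 0, continuous m} ->
  is_derive (0 : R) 1 (fun t => t * m t) (m 0).
Proof.
move=> cm; apply/is_derive1_caratheodory; exists m; split=> // t.
by rewrite mul0r !subr0 mulrC.
Qed.

(** A radial function is only known near the origin through a quadratic bound
    on its profile; this turns that bound into a vanishing gradient. *)
Lemma is_derive_quadratic0 f C :
  (\forall t \near (0 : R), `|f t - f 0| <= C * t ^+ 2) -> is_derive (0 : R) 1 f 0.
Proof.
move=> fC.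
have cm : {for 0, continuous (fun t : R => (f t - f 0) / t)}.
  rewrite /prop_for /continuous_at subrr mul0r; apply/cvgr0Pnorm_le => e e0.
  near=> t; have [->|t0] := eqVneq t 0; first by rewrite invr0 mulr0 normr0 ltW.
  rewrite normrM normfV ler_pdivrMr ?normr_gt0//.
  have fCt : `|f t - f 0| <= C * t ^+ 2 by near: t.
  apply: le_trans fCt _; rewrite -real_normK ?num_real// expr2 mulrA ler_pM2r ?normr_gt0//.
  apply: (@le_trans _ _ ((`|C| + 1) * `|t|)).
    by rewrite ler_wpM2r// (le_trans (ler_norm C))// lerDl.
  have C1 : 0 < `|C| + 1 by rewrite ltr_wpDl.
  rewrite -ler_pdivlMl//; near: t.
  have /cvgr0Pnorm_le : id t @[t --> (0:R)] --> (0 : R) by exact: cvg_id.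
  by apply; rewrite mulr_gt0// invr_gt0.
have d1 := is_derive_id_mul0 cm; rewrite subrr mul0r in d1.
have -> : f = (fun t => t * ((f t - f 0) / t) + f 0).
  apply/funext => t; have [->|t0] := eqVneq t 0; first by rewrite mul0r add0r.
  by field.
by apply: (is_derive_eq (is_deriveD d1 (is_derive_cst (f 0) (0:R) (1:R)))); rewrite addr0.
Unshelve. all: by end_near. Qed.

(** The single place where integration is used. The bound -1 only serves to
    keep 0 in the interior of the domain. *)
Lemma primitive_ex f : continuous f ->
  exists F : R -> R, forall x, -1 < x -> is_derive x 1 F (f x).
Proof.
move=> cf; exists (fun x => \int[lebesgue_measure]_(t in `[-1, x]) f t)%R => x x1.
have fi : lebesgue_measure.-integrable `[-1, x + 1] (EFin \o f).
  apply: continuous_compact_integrable; first exact: segment_compact.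
  exact: continuous_subspaceT.
have [] := @continuous_FTC1_closed _ f (-1) x (x + 1) _ fi x1 (cf x).
  by rewrite ltrDl.
by rewrite derive1E => ? ?; exact: DeriveDef.
Qed.

End Calculus.

Section Clamp.
Context {R : realType}.

(** Profiles matter on [0, 1] only. Precomposing them with this retraction
    makes them continuous on the whole line, which avoids continuity relative
    to a segment. *)
Definition clamp (t : R) : R := Num.max 0 (Num.min t 1).

Lemma clamp_id (t : R) : 0 <= t <= 1 -> clamp t = t.
Proof. by rewrite /clamp => /andP[t0 t1]; rewrite min_l// max_r. Qed.

Lemma clamp_bounds (t : R) : 0 <= clamp t <= 1.
Proof. by rewrite /clamp le_max lexx/= ge_max ler01/= ge_min lexx orbT. Qed.

Lemma clampK (t : R) : clamp (clamp t) = clamp t.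
Proof. exact/clamp_id/clamp_bounds. Qed.

Lemma clamp_lipschitz (x y : R) : `|clamp x - clamp y| <= `|x - y|.
Proof.
rewrite /clamp; wlog xy : x y / x <= y.
  move=> H; have [/H//|/ltW/H] := leP x y.
  by rewrite distrC (distrC y).
rewrite (distrC x) (ger0_norm (_ : 0 <= y - x)) ?subr_ge0//.
case: (leP x 1) => x1; case: (leP y 1) => y1; rewrite /Num.max; repeat case: ifPn => ?;
 rewrite ler_norml; apply/andP; split; lra.
Qed.

Lemma clamp_continuous : continuous clamp.
Proof.
move=> x; apply/cvgrPdist_lt => e e0; near=> y.
apply: le_lt_trans (clamp_lipschitz _ _) _.
by near: y; apply: cvgr_dist_lt => //; exact: cvg_id.
Unshelve. all: by end_near. Qed.

Lemma near_clamp (t : R) : 0 < t < 1 -> \near t, clamp t = t.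
Proof.
move=> t01; near=> s; apply: clamp_id.
have : s \in `]0, 1[ by near: s; apply: near_in_itvoo; rewrite in_itv.
by rewrite in_itv/= => /andP[/ltW -> /ltW ->].
Unshelve. all: by end_near. Qed.

End Clamp.

(** * Radial profiles and the radial Poisson problem *)

Section Radial.
Context {R : realType}.
Implicit Types (r s e x y : R) (N : nat) (h a phi : R -> R).

(** Encodes - Delta (h o |.|) = phi in dimension N as a first order system: a
    is - h' / r, so that the gradient of h o |.| is x |-> - a(|x|) x and r ^ N
    a is the flux of h through the sphere of radius r, up to sign and a
    constant factor. *)
Definition radial_profile N h a phi := forall r : R, 0 < r < 1 ->
  is_derive r 1 h (- (r * a r)) /\
  is_derive r 1 a ((phi r - N%:R * a r) / r).

(** The divergence form of the equation. It is what makes comparison of radial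
    functions elementary: the flux is monotone when the source has a sign. *)
Lemma radial_profile_flux N h a phi r : (0 < N)%N -> radial_profile N h a phi -> 0 < r < 1 ->
  is_derive r 1 (fun t => t ^+ N * a t) (r ^+ N.-1 * phi r).
Proof.
move=> N0 H r01; have [_ da] := H _ r01.
have r0 : r != 0 by rewrite gt_eqF//; case/andP: r01.
apply: (is_derive_eq (is_derive_mul (is_derive_pow N r) da)).
case: N {H da} N0 => // n _ /=.
by rewrite exprS; field.
Qed.

Lemma radial_profileB N h1 a1 phi1 h2 a2 phi2 :
  radial_profile N h1 a1 phi1 -> radial_profile N h2 a2 phi2 ->
  radial_profile N (fun t => h1 t - h2 t) (fun t => a1 t - a2 t)
    (fun t => phi1 t - phi2 t).
Proof.
move=> H1 H2 r r01; have [dh1 da1] := H1 _ r01; have [dh2 da2] := H2 _ r01.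
split.
  by apply: (is_derive_eq (is_deriveB dh1 dh2)); ring.
apply: (is_derive_eq (is_deriveB da1 da2)); field.
by rewrite gt_eqF//; case/andP: r01.
Qed.

(** The hypothesis at 0+ says that no negative point mass sits at the origin;
    the flux then starts from a nonnegative value and increases. *)
Lemma flux_ge0 N h a phi : (0 < N)%N -> radial_profile N h a phi ->
  (forall r, 0 < r < 1 -> 0 <= phi r) ->
  (forall e : R, 0 < e -> \forall r \near 0^'+, - e <= r ^+ N * a r) ->
  forall r, 0 < r < 1 -> 0 <= a r.
Proof.
move=> N0 H phi0 lim0 r r01; have /andP[r0 r1] := r01.
rewrite -(pmulr_rge0 (a r) (exprn_gt0 N r0)); apply/ler_addgt0Pr => e e0.
rewrite -lerBlDr sub0r.
have [s [s0 sr es]] : exists s, [/\ 0 < s, s < r & - e <= s ^+ N * a s].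
  near (0:R)^'+ => s; exists s; split => //.
  by near: s; exact: lim0.
apply: le_trans es _.
pose J t := t ^+ N * a t.
have dJ t : s <= t <= r -> is_derive t 1 J (t ^+ N.-1 * phi t).
  move=> /andP[st tr]; apply: (radial_profile_flux N0 H).
  by rewrite (lt_le_trans s0 st) (le_lt_trans tr r1).
apply: (@le_of_derive_ge0 _ J (fun t => t ^+ N.-1 * phi t)); first exact: ltW.
- by move=> t /andP[/ltW st /ltW tr]; apply: dJ; rewrite st.
- move=> t /andP[st tr]; have t0 := lt_trans s0 st.
  by rewrite mulr_ge0 ?exprn_ge0 ?(ltW t0)// phi0// t0 (lt_trans tr).
- exact: within_of_derive dJ.
Unshelve. all: by end_near. Qed.

Lemma profile_ge_boundary N h a phi : radial_profile N h a phi ->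
  (forall r, 0 < r < 1 -> 0 <= a r) ->
  {within `]0, 1], continuous h} ->
  forall r, 0 < r <= 1 -> h 1 <= h r.
Proof.
move=> H a0 ch r /andP[r0 r1].
rewrite -lerN2; apply: (@le_of_derive_ge0 _ (fun t => - h t) (fun t => t * a t)) => //.
- move=> x /andP[rx x1]; have [|dh _] := H x; first by rewrite (lt_trans r0 rx) x1.
  by apply: (is_derive_eq (is_deriveN dh)); rewrite opprK.
- move=> x /andP[rx x1]; have x0 := lt_trans r0 rx.
  by rewrite mulr_ge0 ?(ltW x0)// a0// x0.
- move=> x; apply: cvgN; apply: continuous_subspaceW ch x.
  by move=> t /=; rewrite !in_itv/= => /andP[rt ->]; rewrite (lt_le_trans r0).
Qed.

(** The second function may have a singularity of the favourable sign at the
    origin: only the nonnegativity of its slope is required there, while the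
    flux of the first one has to vanish. Supersolutions with a concave kink, as
    they occur in dimension one, are thus allowed. *)
Lemma profile_comparison N h1 a1 phi1 h2 a2 phi2 : (0 < N)%N ->
  radial_profile N h1 a1 phi1 -> radial_profile N h2 a2 phi2 ->
  (forall r, 0 < r < 1 -> phi1 r <= phi2 r) ->
  r ^+ N * a1 r @[r --> 0^'+] --> (0:R) ->
  (forall r, 0 < r < 1 -> 0 <= a2 r) ->
  {within `]0, 1], continuous h1} -> {within `]0, 1], continuous h2} ->
  h1 1 <= h2 1 ->
  forall r, 0 < r <= 1 -> h1 r <= h2 r.
Proof.
move=> N0 H1 H2 phi12 a10 a20 ch1 ch2 h12 r r01.
have H := radial_profileB H2 H1.
suff : h2 1 - h1 1 <= h2 r - h1 r.
  by move: h12; lra.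
apply: (profile_ge_boundary H) => //.
  apply: (flux_ge0 N0 H).
    by move=> x x01; rewrite subr_ge0 phi12.
  move=> e e0; near=> x.
  have x01 : 0 < x < 1.
    by apply/andP; split; near: x; [exact: nbhs_right_gt|exact: nbhs_right_lt].
  rewrite mulrBr lerNl opprB.
  have : `|0 - x ^+ N * a1 x| < e.
    by near: x; move/cvgrPdist_lt : a10; exact.
  rewrite sub0r normrN ltr_norml => /andP[_ /ltW]; apply: le_trans.
  rewrite gerBl mulr_ge0// ?a20//.
  by rewrite exprn_ge0//; case/andP : x01 => /ltW.
by move=> x; apply: cvgB; [exact: ch2|exact: ch1].
Unshelve. all: by end_near. Qed.

(** The function h is required to be constant outside [0, 1], which makes it
    unique and continuous on the line. *)
Definition radial_poisson N phi h := exists a : R -> R,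
  [/\ radial_profile N h a phi, continuous a, a 0 = phi 0 / N%:R &
   [/\ continuous h, h 1 = 0 & forall r, h (clamp r) = h r]].

Lemma flux_cvg0 N a : (0 < N)%N -> {for 0, continuous a} ->
  r ^+ N * a r @[r --> 0^'+] --> (0:R).
Proof.
move=> N0 ca; rewrite -[X in _ --> X](mul0r (a 0)).
have cX : (r:R) ^+ N @[r --> 0^'+] --> (0:R).
  rewrite -[X in _ --> X](_ : 0 ^+ N = 0); last by rewrite expr0n gtn_eqF.
  by apply: cvg_at_right_filter; exact: exprn_continuous.
by apply: cvgM => //; exact: cvg_at_right_filter.
Qed.

Lemma radial_poisson_ge0 N phi h a : (0 < N)%N -> radial_profile N h a phi ->
  continuous a -> (forall r, 0 <= r <= 1 -> 0 <= phi r) ->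
  forall r, 0 < r < 1 -> 0 <= a r.
Proof.
move=> N0 H ca phi0; apply: (flux_ge0 N0 H).
  by move=> r /andP[/ltW r0 /ltW r1]; apply: phi0; rewrite r0.
move=> e e0; have /cvgrPdist_lt/(_ _ e0) := flux_cvg0 N0 (ca 0).
apply: filterS => x; rewrite sub0r normrN ltr_norml => /andP[]; lra.
Qed.

End Radial.

Section Poisson.
Context {R : realType}.
Implicit Types (r s e x y t : R) (N : nat) (h a phi H : R -> R).

(** By continuity of phi at the origin, H(r) is phi(0) r ^ N / N up to a factor
    close to 1. *)
Lemma ball_average_cvg N phi H : (0 < N)%N -> continuous phi -> H 0 = 0 ->
  (forall t, -1 < t -> is_derive t 1 H (t ^+ N.-1 * phi t)) ->
  H r / r ^+ N @[r --> 0^'+] --> phi 0 / N%:R.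
Proof.
move=> N0 cphi H0 dH; apply/cvgrPdist_le => e e0.
have Npos : 0 < N%:R :> R by rewrite ltr0n.
have [d d0 near_phi] : exists2 d, 0 < d & forall t, 0 <= t < d -> `|phi 0 - phi t| <= e.
  have /cvgrPdist_le/(_ _ e0) := cphi 0.
  move=> /nbhs_ballP[d d0 dP]; exists d => // t /andP[t0 td]; apply: dP.
  by rewrite /ball/= sub0r normrN ger0_norm.
have dHc c t : 0 <= t -> is_derive t 1 (fun t => H t - c * (t ^+ N / N%:R))
    (t ^+ N.-1 * (phi t - c)).
  move=> t0; have dHt := dH t (lt_le_trans (ltrN10 R) t0).
  have dp : is_derive t 1 (fun t => c * (t ^+ N / N%:R)) (c * t ^+ N.-1).
    have := is_derive_scale (c / N%:R) (is_derive_pow N t).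
    rewrite [X in is_derive _ _ X](_ : _ = (fun t => c * (t ^+ N / N%:R))).
      by move=> dd; apply: (is_derive_eq dd); rewrite mulrA divfK// gt_eqF.
    by apply/funext => u; rewrite mulrAC mulrA.
  by apply: (is_derive_eq (is_deriveB dHt dp)); ring.
near=> r.
have r0 : 0 < r by near: r; exact: nbhs_right_gt.
have rd : r < d by near: r; exact: nbhs_right_lt.
have rN : 0 < r ^+ N by rewrite exprn_gt0.
have phir t : 0 < t < r -> `|phi 0 - phi t| <= e.
  by move=> /andP[t0 tr]; apply: near_phi; rewrite (ltW t0) (lt_trans tr).
have low : 0 <= H r - (phi 0 - e) * (r ^+ N / N%:R).
  have := @le_of_derive_ge0 _ _ _ 0 r (ltW r0) (fun t tP => dHc (phi 0 - e) t (ltW (andP tP).1)).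
  rewrite H0 expr0n gtn_eqF// mul0r mulr0 subr0; apply.
    move=> t /[dup] tr /andP[t0 _]; rewrite mulr_ge0 ?exprn_ge0 ?(ltW t0)//.
    by have := phir _ tr; rewrite ler_norml => /andP[]; lra.
  by apply: within_of_derive => t /andP[t0 _]; exact: dHc.
have upp : 0 <= - (H r - (phi 0 + e) * (r ^+ N / N%:R)).
  have := @le_of_derive_ge0 _ _ _ 0 r (ltW r0)
    (fun t tP => is_deriveN (dHc (phi 0 + e) t (ltW (andP tP).1))).
  rewrite !fctE H0 expr0n gtn_eqF// mul0r mulr0 subr0 oppr0; apply.
    move=> t /[dup] tr /andP[t0 _]; rewrite -mulrN mulr_ge0 ?exprn_ge0 ?(ltW t0)//.
    by have := phir _ tr; rewrite ler_norml => /andP[]; lra.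
  by apply: within_of_derive => t /andP[t0 _]; apply: is_deriveN; exact: dHc.
have -> : phi 0 / N%:R - H r / r ^+ N =
    - (H r - phi 0 * (r ^+ N / N%:R)) / r ^+ N.
  by move: rN Npos => /lt0r_neq0 ? /lt0r_neq0 ?; field; apply/andP.
rewrite normrM normfV (gtr0_norm rN) ler_pdivrMr// normrN.
have N1 : r ^+ N / N%:R <= r ^+ N.
  by rewrite ler_pdivrMr// ler_peMr ?(ltW rN)// ler1n.
have eN : e * (r ^+ N / N%:R) <= e * r ^+ N by rewrite ler_pM2l.
by rewrite ler_norml; apply/andP; split; lra.
Unshelve. all: by end_near. Qed.

(** Two successive primitives: first the flux, then h. Between them one divides
    the flux by r ^ N, and the quotient extends continuously to the origin by
    [ball_average_cvg]. *)
Lemma radial_poisson_ex N phi : (0 < N)%N -> continuous phi ->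
  exists h, radial_poisson N phi h.
Proof.
move=> N0 cphi.
have cXphi : continuous (fun t : R => t ^+ N.-1 * phi t).
  by move=> t; apply: cvgM; [exact: exprn_continuous|exact: cphi].
have [H0 dH0] := primitive_ex cXphi.
pose H t := H0 t - H0 0.
have HH t : -1 < t -> is_derive t 1 H (t ^+ N.-1 * phi t).
  by move=> t1; apply: (is_derive_eq (is_deriveB (dH0 _ t1) (is_derive_cst _ _ _))); rewrite subr0.
have H00 : H 0 = 0 by rewrite /H subrr.
pose a0 (r : R) := if 0 < r then H r / r ^+ N else phi 0 / N%:R.
have da0 (r : R) : 0 < r -> is_derive r 1 a0 ((phi r - N%:R * a0 r) / r).
  move=> r0; have rn0 : r != 0 by rewrite gt_eqF.
  have rN0 : r ^+ N != 0 by rewrite expf_eq0 negb_and rn0 orbT.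
  apply: (@near_eq_is_derive _ _ _ (fun r => H r * (r ^+ N)^-1)).
    near=> s; rewrite /a0 ifT//; near: s; exact: lt_nbhsr.
  apply: (is_derive_eq (is_derive_mul (HH r (lt_trans (ltrN10 R) r0))
     (@is_derive_inv _ (fun t => t ^+ N) _ _ rN0 (is_derive_pow N r)))).
  rewrite /a0 r0; case: (N) N0 rN0 => // n _ _ /=.
  rewrite exprS; field; rewrite rn0/=.
  by rewrite expf_eq0 (negbTE rn0) andbF.
have ca0 r : 0 <= r -> {for r, continuous a0}.
  rewrite le_eqVlt => /predU1P[<-|/da0]; last exact: is_derive_continuous.
  have a00 : a0 0 = phi 0 / N%:R by rewrite /a0 ltxx.
  apply/left_right_continuousP; split.
    rewrite a00; apply: cvg_near_cst; near=> s; apply/eqP.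
    by rewrite /a0 ltNge (_ : s <= 0)//; near: s; exact: nbhs_left_le.
  rewrite a00; apply: cvg_trans (ball_average_cvg N0 cphi H00 HH).
  by apply: near_eq_cvg; near=> s; rewrite /a0 ifT.
pose a := a0 \o clamp.
have ca : continuous a.
  move=> t; apply: continuous_comp; first exact: clamp_continuous.
  by apply: ca0; case/andP: (clamp_bounds t).
have cXa : continuous (fun t : R => t * a t).
  by move=> t; apply: cvgM; [exact: cvg_id|exact: ca].
have [K dK] := primitive_ex cXa.
exists (fun r => K 1 - K (clamp r)), a; split => //.
- move=> r r01; have /andP[r0 r1] := r01.
  have rc : clamp r = r by rewrite clamp_id// !ltW.
  split.
    have nearr := near_clamp r01.
    have dKr := dK r (lt_trans (ltrN10 R) r0).
    apply: (@near_eq_is_derive _ _ _ (fun r => K 1 - K r)).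
      by near=> s; rewrite (_ : clamp s = s)//; near: s.
    by apply: (is_derive_eq (is_deriveB (is_derive_cst _ _ _) dKr)); rewrite sub0r.
  apply: (@near_eq_is_derive _ _ _ a0).
    near=> s; rewrite /a/= (_ : clamp s = s)//; near: s; exact: near_clamp.
  by rewrite /a/= rc; exact: da0.
- by rewrite /a/= clamp_id ?lexx ?ler01// /a0 ltxx.
split.
- move=> t; apply: cvgB; first exact: cvg_cst.
  apply: continuous_comp; first exact: clamp_continuous.
  apply: is_derive_continuous (dK _ _).
  by rewrite (lt_le_trans (ltrN10 R))//; case/andP: (clamp_bounds t).
- by rewrite clamp_id ?lexx ?ler01// subrr.
- by move=> r; rewrite clampK.
Unshelve. all: by end_near. Qed.

Lemma radial_poisson_le N phi1 phi2 h1 h2 : (0 < N)%N ->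
  radial_poisson N phi1 h1 -> radial_poisson N phi2 h2 ->
  (forall r, 0 <= r <= 1 -> 0 <= phi1 r <= phi2 r) ->
  forall r, h1 r <= h2 r.
Proof.
move=> N0 [a1 [H1 ca1 _ [ch1 h11 hc1]]] [a2 [H2 ca2 _ [ch2 h21 hc2]]] phi12.
have le01 r : 0 < r <= 1 -> h1 r <= h2 r.
  apply: (profile_comparison N0 H1 H2).
  - move=> s /andP[/ltW s0 /ltW s1].
    by have /andP[] : 0 <= phi1 s <= phi2 s by apply: phi12; rewrite s0.
  - exact: flux_cvg0 N0 (ca1 0).
  - apply: (radial_poisson_ge0 N0 H2 ca2) => // s s01.
    by have /andP[p0 p1] := phi12 _ s01; exact: le_trans p1.
  - exact: continuous_subspaceT.
  - exact: continuous_subspaceT.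
  - by rewrite h11 h21.
move=> r; rewrite -hc1 -hc2; have := clamp_bounds r; move: (clamp r) => {}r.
rewrite le_eqVlt => /andP[/predU1P[<-|r0 r1]]; last by apply: le01; rewrite r0.
move=> _; rewrite -subr_ge0.
have c12 : h2 x - h1 x @[x --> 0^'+] --> h2 0 - h1 0.
  by apply: cvgB; apply: cvg_at_right_filter; [exact: ch2|exact: ch1].
rewrite -(cvg_lim _ c12)//; apply: limr_ge; first by apply/cvg_ex; eexists; exact: c12.
near=> s; rewrite subr_ge0; apply: le01; apply/andP; split.
  by near: s; exact: nbhs_right_gt.
by near: s; exact: nbhs_right_le.
Unshelve. all: by end_near. Qed.

Lemma radial_poisson0 N h : radial_poisson N (fun=> 0) h -> (0 < N)%N -> forall r, h r = 0.
Proof.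
move=> Hh N0 r; have H0 : radial_poisson N (fun=> 0 : R) (fun=> 0).
  exists (fun=> 0); split => //; last by split => //; move=> ?; exact: cvg_cst.
  - move=> s _; split; apply: (is_derive_eq (is_derive_cst _ _ _)).
      by rewrite mulr0 oppr0.
    by rewrite mulr0 subr0 mul0r.
  - by move=> ?; exact: cvg_cst.
  - by rewrite mul0r.
apply/eqP; rewrite eq_le.
by rewrite (radial_poisson_le N0 Hh H0) ?(radial_poisson_le N0 H0 Hh) => // *; rewrite lexx.
Qed.

(** The slope a is at most C / N, by comparison with the parabola C (1 - r ^ 2)
    / (2 N), so that |h'| = r a is at most C. The uniform constant is what
    keeps suprema of families of subsolutions continuous. *)
Lemma radial_poisson_lipschitz N phi h C : (0 < N)%N -> radial_poisson N phi h ->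
  (forall r, 0 <= r <= 1 -> 0 <= phi r <= C) ->
  forall x y, `|h x - h y| <= C * `|x - y|.
Proof.
move=> N0 [a [H ca a00 [ch h1 hc]]] phiC.
have C0 : 0 <= C.
  by have /andP[] := phiC 0 (introT andP (conj (lexx 0) ler01)); exact: le_trans.
have a0 r : 0 < r < 1 -> 0 <= a r.
  by apply: (radial_poisson_ge0 N0 H ca) => // s /phiC/andP[].
have Npos : 0 < N%:R :> R by rewrite ltr0n.
have aC r : 0 < r < 1 -> a r <= C / N%:R.
  move=> r01.
  have HC : radial_profile N (fun r => C / N%:R / 2 * (1 - r ^+ 2)) (fun=> C / N%:R) (fun=> C).
    move=> s /andP[s0 s1]; split; last first.
      apply: (is_derive_eq (is_derive_cst _ _ _)).
      by rewrite (mulrC N%:R) divfK ?subrr ?mul0r// gt_eqF.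
    have d1 : is_derive s 1 (fun=> 1 : R) 0 by exact: is_derive_cst.
    apply: (is_derive_eq (is_derive_scale (C / N%:R / 2) (is_deriveB d1 (is_derive_pow 2 s)))).
    by field; rewrite gt_eqF.
  rewrite -subr_ge0; apply: (flux_ge0 N0 (radial_profileB HC H)) => //.
    move=> s /andP[/ltW s0 /ltW s1]; rewrite subr_ge0.
    by case/andP: (phiC s (introT andP (conj s0 s1))).
  move=> e e0.
  have cC : {for 0, continuous (fun r => C / N%:R - a r)}.
    by apply: cvgB; [exact: cvg_cst|exact: ca].
  have /cvgrPdist_lt/(_ _ e0) := flux_cvg0 N0 cC.
  by apply: filterS => s; rewrite sub0r normrN ltr_norml => /andP[]; lra.
have main x y : 0 <= x -> x <= y -> y <= 1 -> 0 <= h x - h y <= C * (y - x).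
  move=> x0 xy y1; apply/andP; split.
    rewrite subr_ge0 -lerN2; apply: (@le_of_derive_ge0 _ (fun t => - h t) (fun t => t * a t)) => //.
    - move=> t /andP[xt ty]; have t01 : 0 < t < 1 by rewrite (le_lt_trans x0 xt) (lt_le_trans ty).
    have [dh _] := H t t01.
      by apply: (is_derive_eq (is_deriveN dh)); rewrite opprK.
    - move=> t /andP[xt ty]; have t0 := le_lt_trans x0 xt.
      by rewrite mulr_ge0 ?(ltW t0)// a0// t0 (lt_le_trans ty).
    - by apply: continuous_subspaceT => t; apply: cvgN; exact: ch.
  suff : h x + C * x <= h y + C * y by lra.
  apply: (@le_of_derive_ge0 _ (fun t => h t + C * t) (fun t => - (t * a t) + C)) => //.
  - move=> t /andP[xt ty]; have t01 : 0 < t < 1 by rewrite (le_lt_trans x0 xt) (lt_le_trans ty).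
    have [dh _] := H t t01.
    have dC := is_derive_scale C (is_derive_id t (1:R)).
    by apply: (is_derive_eq (is_deriveD dh dC)); ring.
  - move=> t /andP[xt ty]; have t0 := le_lt_trans x0 xt; have t1 := lt_le_trans ty y1.
    have t01 : 0 < t < 1 by rewrite t0.
    rewrite addrC subr_ge0; apply: (@le_trans _ _ (1 * (C / N%:R))).
      by apply: ler_pM; [exact: ltW|exact: a0|exact: ltW|exact: aC].
    by rewrite mul1r ler_pdivrMr// ler_peMr// ler1n.
  - apply: continuous_subspaceT => t; apply: cvgD; first exact: ch.
    by apply: cvgM; [exact: cvg_cst|exact: cvg_id].
move=> x y; rewrite -(hc x) -(hc y); apply: (@le_trans _ _ (C * `|clamp x - clamp y|)); last first.
  by rewrite ler_wpM2l// clamp_lipschitz.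
have /andP[x0 x1] := clamp_bounds x; have /andP[y0 y1] := clamp_bounds y.
move: (clamp x) (clamp y) x0 x1 y0 y1 => {}x {}y x0 x1 y0 y1.
wlog xy : x y x0 x1 y0 y1 / x <= y.
  by move=> W; have [/W|/ltW/W] := leP x y; [exact|rewrite distrC (distrC x); exact].
have /andP[p0 p1] := main _ _ x0 xy y1.
by rewrite ger0_norm// ler0_norm ?subr_le0// opprB.
Qed.

End Poisson.

(** * Radial solutions as monotone fixed points *)

Section Nonlinearity.
Context {R : realType} {aF : \bar R} {F : R -> R} (hF : nonlinearity aF F).
Implicit Types (x y M : R).

Lemma nl_domain_le x y : 0 <= x -> x <= y -> nl_domain aF y -> nl_domain aF x.
Proof. by move=> x0 xy [_ yaF]; split=> //; apply: le_lt_trans yaF; rewrite lee_fin. Qed.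

Lemma nonlinearity_le x y : 0 <= x -> x <= y -> nl_domain aF y -> F x <= F y.
Proof.
move=> x0 + dy; rewrite le_eqVlt => /predU1P[->//|xy].
have dx := nl_domain_le x0 (ltW xy) dy.
by have [_ Finc _ _] := hF; rewrite ltW// Finc// inE.
Qed.

Lemma nonlinearity_ge1 x : nl_domain aF x -> 1 <= F x.
Proof. by move=> dx; case: (hF) => _ _ _ <-; apply: nonlinearity_le => //; case: dx. Qed.

Lemma nonlinearity_continuous (T : topologicalType) (v : T -> R) (t : T) :
  {for t, continuous v} -> (forall s, nl_domain aF (v s)) -> {for t, continuous (F \o v)}.
Proof.
move=> cv dv; have [[G [e [e0 GF Gsmooth]]] _ _ _] := hF.
have -> : F \o v = G \o v by apply/funext => s /=; rewrite GF.
apply: continuous_comp => //; have [v0 vaF] := dv t.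
have /= := Gsmooth 0%N (v t); rewrite (lt_le_trans _ v0) ?oppr_lt0// => /(_ isT vaF) dG.
by apply: differentiable_continuous; exact/derivable1_diffP.
Qed.

(** Convexity of F makes the even part of a solution a supersolution in
    dimension one. *)
Lemma nonlinearity_midpoint x y : nl_domain aF x -> nl_domain aF y ->
  F ((x + y) / 2) <= (F x + F y) / 2.
Proof.
move=> dx dy; have [_ _ Fconv _] := hF.
have half01 : Itv.spec (@Itv.num_sem R) (Itv.Real `[0%Z, 1%Z]) (2^-1 : R).
  apply/and3P; split; [exact: num_real|rewrite /= ?bnd_simp|rewrite /= ?bnd_simp]; lra.
have := Fconv (Itv.mk half01) x y; rewrite !inE => /(_ dx dy).
rewrite !convRE/=.
rewrite [conv _ _ _](_ : _ = (x + y) / 2); last first.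
  by rewrite /conv/= /unstable.onem /GRing.scale/=; field.
by have -> : 2^-1 * F x + unstable.onem 2^-1 * F y = (F x + F y) / 2
  by rewrite /unstable.onem; field.
Qed.

End Nonlinearity.

Section Weight.
Context {R : realType}.
Implicit Types (alpha lambda r : R).

(** Continuity from the right at 0 covers both alpha > 0, where the value is 0,
    and alpha = 0, where it is 1. *)
Lemma powR_continuous_ge0 alpha : 0 <= alpha ->
  forall r, 0 <= r -> t `^ alpha @[t --> within [set t | 0 <= t] (nbhs r)] --> r `^ alpha.
Proof.
rewrite le_eqVlt => /predU1P[<- r _|alpha0 r].
  by apply: cvg_near_cst; near=> t; rewrite !powRr0.
rewrite le_eqVlt => /predU1P[<-|r0]; last first.
  apply: cvg_within_filter; exact: is_derive_continuous (is_derive1_powR _ r0).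
rewrite powR0 ?gt_eqF//.
apply/cvgrPdist_lt => e e0.
have /cvgrPdist_lt/(_ _ e0) := powR_cvg0 alpha0.
rewrite !near_withinE; apply: filterS => t tP /=.
rewrite le_eqVlt => /predU1P[<-|/tP//]; by rewrite powR0 ?gt_eqF// subr0 normr0.
Unshelve. all: by end_near. Qed.

Lemma powR_comp_continuous (T : topologicalType) (k : T -> R) alpha (t : T) :
  0 <= alpha -> {for t, continuous k} -> (forall s, 0 <= k s) ->
  {for t, continuous (fun s => k s `^ alpha)}.
Proof.
move=> alpha0 ck k0; apply: cvg_trans (powR_continuous_ge0 alpha0 (k0 t)).
move=> A; rewrite !nbhs_simpl/= => /ck; rewrite !nbhs_simpl/=.
by apply: filterS => s; exact.
Qed.

Definition source (F : R -> R) alpha lambda (v : R -> R) : R -> R :=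
  fun r => lambda * clamp r `^ alpha * F (v r).

End Weight.

Section FixedPoint.
Context {R : realType} {aF : \bar R} {F : R -> R} (hF : nonlinearity aF F).
Implicit Types (r c M alpha lambda : R) (N : nat) (v h u : R -> R).

(** The bound M < aF makes the solution classical: in the singular case it
    keeps u away from 1. *)
Definition radial_solution N alpha lambda u : Prop :=
  radial_poisson N (source F alpha lambda u) u /\
  exists M, [/\ (M%:E < aF)%E, 0 <= M & forall r, 0 <= u r <= M].

Lemma source_continuous alpha lambda v : 0 <= alpha -> continuous v ->
  (forall r, nl_domain aF (v r)) -> continuous (source F alpha lambda v).
Proof.
move=> alpha0 cv dv t; apply: cvgM; last exact: (nonlinearity_continuous hF (cv t) dv).
apply: cvgM; first exact: cvg_cst.
apply: powR_comp_continuous => //; first exact: clamp_continuous.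
by move=> s; case/andP: (clamp_bounds s).
Qed.

Lemma source_le alpha lambda v u r : 0 <= lambda -> 0 <= v r -> v r <= u r ->
  nl_domain aF (u r) -> 0 <= source F alpha lambda v r <= source F alpha lambda u r.
Proof.
move=> lambda0 v0 vu du; rewrite /source.
have w0 : 0 <= lambda * clamp r `^ alpha by rewrite mulr_ge0// powR_ge0.
rewrite mulr_ge0 ?ler_wpM2l//; first exact: (nonlinearity_le hF).
by apply: le_trans (nonlinearity_ge1 hF _); rewrite ?ler01//; exact: nl_domain_le du.
Qed.

(** Existence of a radial solution below any barrier B that the map T : v |->
    solution h of the linear problem with source lambda r ^ alpha F(v)
    respects. Instead of iterating T, which would require passing to the limit
    in the equation, one takes the supremum u of all Lipschitz subsolutions v
    <= T v below the barrier, in the manner of Knaster and Tarski: u <= T u by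
    monotonicity, and T u is again such a subsolution, so T u <= u. The barrier
    is a relation rather than a function, because it is used with a nonradial
    solution w, whose values at all the points of a sphere are barriers for the
    same radius. *)
Lemma fixpoint_below N alpha lambda M (B : R -> R -> Prop) :
  (0 < N)%N -> 0 <= alpha -> 0 <= lambda -> 0 <= M -> (M%:E < aF)%E ->
  (forall r c, B r c -> 0 <= c) ->
  (forall v h, continuous v -> (forall r, 0 <= v r <= M) ->
     (forall r c, B r c -> v r <= c) ->
     radial_poisson N (source F alpha lambda v) h ->
     (forall r, h r <= M) /\ (forall r c, B r c -> h r <= c)) ->
  exists u, [/\ radial_solution N alpha lambda u, forall r, u r <= M &
                forall r c, B r c -> u r <= c].
Proof.
move=> N0 alpha0 lambda0 M0 MaF B0 BP.
(* An upper bound for all the sources, hence a common Lipschitz constant. *)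
pose L := lambda * F M.
have dM : nl_domain aF M by [].
have dv v r : 0 <= v r <= M -> nl_domain aF (v r).
  by move=> /andP[v0 vM]; exact: nl_domain_le dM.
have FM1 := nonlinearity_ge1 hF dM.
have L0 : 0 <= L by rewrite mulr_ge0// (le_trans ler01).
have source_bnd v r : 0 <= v r <= M -> 0 <= source F alpha lambda v r <= L.
  move=> vM; have /andP[v0 v1] := vM.
  have /andP[-> /= H] := @source_le alpha lambda v (fun=> M) r lambda0 v0 v1 dM.
  apply: le_trans H _; rewrite /source /L ler_wpM2r//; first exact: le_trans ler01 _.
  rewrite ler_piMr//; have /andP[c0 c1] := clamp_bounds r.
  by rewrite -[leRHS](_ : 1 `^ alpha = 1) ?ge0_ler_powR ?nnegrE// powR1.
pose lip v := forall x y, `|v x - v y| <= L * `|x - y|.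
have lip_cont v : lip v -> continuous v.
  move=> lv x; apply/cvgrPdist_lt => e e0; near=> y.
  apply: le_lt_trans (lv _ _) _.
  apply: (@le_lt_trans _ _ ((L + 1) * `|x - y|)); first by rewrite ler_wpM2r// lerDl.
  rewrite -ltr_pdivlMl ?ltr_wpDl//; near: y.
  by apply: cvgr_dist_lt; [exact: cvg_id|rewrite mulr_gt0 ?invr_gt0 ?ltr_wpDl].
pose S : set (R -> R) := [set v | [/\ lip v, forall r, 0 <= v r <= M,
   forall r c, B r c -> v r <= c &
   exists2 h, radial_poisson N (source F alpha lambda v) h & forall r, v r <= h r]].
have T_S v h : lip v -> (forall r, 0 <= v r <= M) -> (forall r c, B r c -> v r <= c) ->
    radial_poisson N (source F alpha lambda v) h -> (forall r, v r <= h r) -> S h.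
  move=> lv vM vB hv vh; have [hM hB] := BP v h (lip_cont _ lv) vM vB hv.
  have lh : lip h by apply: (radial_poisson_lipschitz N0 hv) => r _; exact: source_bnd.
  have h0M r : 0 <= h r <= M by rewrite hM andbT (le_trans _ (vh r))//; case/andP: (vM r).
  split => //.
  have [k hk] := radial_poisson_ex N0 (source_continuous (lambda := lambda) alpha0
    (lip_cont _ lh) (fun r => dv _ _ (h0M r))).
  exists k => // r; apply: (radial_poisson_le N0 hv hk) => s _.
  apply: source_le => //; [by case/andP: (vM s)|exact: dv].
have S0 : S (fun=> 0).
  have c0 : continuous ((fun=> 0) : R -> R) by exact: cst_continuous.
  split => //.
  - by move=> x y; rewrite subrr normr0 mulr_ge0.
  - by move=> r; rewrite lexx M0.
  - have d0 r : nl_domain aF ((fun=> 0 : R) r) by apply: nl_domain_le dM; rewrite ?lexx.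
    have [k hk] := radial_poisson_ex N0 (source_continuous (lambda := lambda) alpha0 c0 d0).
    exists k => // r.
    have [z hz] := radial_poisson_ex N0 c0.
    rewrite -(radial_poisson0 hz N0 r); apply: (radial_poisson_le N0 hz hk) => s _.
    by rewrite lexx; case/andP: (source_bnd (fun=> 0) s (introT andP (conj (lexx 0) M0))).
pose u r := sup [set v r | v in S].
have ubS r : has_ubound [set v r | v in S].
  by exists M => _ [v [_ vM _ _] <-]; case/andP: (vM r).
have le_u v r : S v -> v r <= u r by move=> Sv; apply: ub_le_sup => //; exists v.
have u_le r c : (forall v, S v -> v r <= c) -> u r <= c.
  by move=> H; apply: ge_sup; [exists 0, (fun=> 0)|move=> _ [v /H ? <-]].
have uM r : 0 <= u r <= M.
  apply/andP; split; first exact: (le_u (fun=> 0) r S0).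
  by apply: u_le => v [_ /(_ r) /andP[]].
have lu : lip u.
  have half x y : u x <= u y + L * `|x - y|.
    apply: u_le => v Sv; have [lv _ _ _] := Sv.
    have := lv x y; rewrite ler_norml => /andP[_].
    by have := le_u _ y Sv; lra.
  move=> x y; rewrite ler_norml; have := half x y; have := half y x.
  by rewrite (distrC y x) => ? ?; apply/andP; split; lra.
have uB r c : B r c -> u r <= c by move=> Brc; apply: u_le => v [_ _ /(_ _ _ Brc)].
have cu := lip_cont _ lu.
have [h hu] := radial_poisson_ex N0 (source_continuous (lambda := lambda) alpha0
  cu (fun r => dv _ _ (uM r))).
have uh r : u r <= h r.
  apply: u_le => v Sv; have [_ vM _ [k hk vk]] := Sv.
  apply: le_trans (vk r) _; apply: (radial_poisson_le N0 hk hu) => s _.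
  apply: source_le => //; [by case/andP: (vM s)|exact: le_u|exact: dv].
have Sh : S h by exact: T_S hu uh.
have hE : h = u by apply/funext => r; apply/eqP; rewrite eq_le uh le_u.
exists u; split => //; last by move=> r; case/andP: (uM r).
by split; [rewrite -{2}hE|exists M].
Unshelve. all: by end_near. Qed.

End FixedPoint.
Arguments radial_solution {R} aF F N alpha lambda u.

(** * Radial functions of several variables *)

Section Directional.
Context {R : realType} {V : normedModType R}.
Implicit Types (u g : V -> R) (v x : V).

(** Directional derivatives are derivatives along lines; this transfers the
    one-variable calculus. *)
Lemma is_derive_line0 u x v d :
  is_derive x v u d <-> is_derive (0 : R) 1 (fun t : R => u (t *: v + x)) d.
Proof.
suff E : (fun h : R => h^-1 *: ((u \o shift x) (h *: v) - u x)) =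
    (fun h : R => h^-1 *: (((fun t : R => u (t *: v + x)) \o shift 0) (h *: 1)
       - u (0 *: v + x))).
  split=> -[ud uE]; split; [by rewrite /derivable -E|by rewrite -uE /derive -E|
    by rewrite /derivable E|by rewrite -uE /derive E].
by rewrite funeqE => h /=; rewrite addr0 scale0r add0r [_%:A]mulr1.
Qed.

Lemma line_cvg v x : t *: v + x @[t --> (0 : R)] --> x.
Proof.
rewrite -[X in _ --> X](_ : 0 *: v + x = x); last by rewrite scale0r add0r.
by apply: cvgD; [apply: cvgZ; [exact: cvg_id|exact: cvg_cst]|exact: cvg_cst].
Qed.

Lemma is_derive_compl (f : R -> R) g x v a b :
  is_derive (g x) 1 f a -> is_derive x v g b -> is_derive x v (f \o g) (a * b).
Proof.
move=> fa /is_derive_line0 gb; apply/is_derive_line0.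
have fa' : is_derive (g (0 *: v + x)) 1 f a by rewrite scale0r add0r.
exact: (is_derive1_comp fa' gb).
Qed.

End Directional.

Lemma is_derive_line {R : realType} {V : normedModType R} (u : V -> R) (x v : V)
    (t : R) d :
  is_derive (t *: v + x) v u d <-> is_derive t 1 (fun t : R => u (t *: v + x)) d.
Proof.
split=> [/is_derive_line0 H|/is_derive_line0 H]; apply/is_derive_line0; move: H;
  rewrite (_ : (fun s : R => u (s *: v + (t *: v + x))) =
               (fun s : R => u ((s *: (1:R) + t) *: v + x)))//;
  by apply/funext => s; rewrite addrA -scalerDl [_%:A]mulr1.
Qed.

Section EuclideanNorm.
Context {R : realType} {N : nat}.
Implicit Types (x y : 'rV[R]_N) (i j : 'I_N) (r : R).

Lemma enorm_ge0 x : 0 <= enorm x. Proof. exact: sqrtr_ge0. Qed.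

Lemma enorm_sqr x : enorm x ^+ 2 = \sum_(i < N) x 0 i ^+ 2.
Proof. by rewrite sqr_sqrtr// sumr_ge0// => i _; rewrite sqr_ge0. Qed.

Lemma coord_le_enorm x i : `|x 0 i| <= enorm x.
Proof.
rewrite -ler_sqr ?nnegrE ?enorm_ge0// enorm_sqr (bigD1 i)//= real_normK ?num_real//.
by rewrite lerDl sumr_ge0// => j _; rewrite sqr_ge0.
Qed.

Lemma enorm_eq0 x : (enorm x == 0) = (x == 0).
Proof.
apply/eqP/eqP => [x0|->]; last first.
  by rewrite /enorm big1 ?sqrtr0// => i _; rewrite mxE expr0n.
apply/rowP => i; rewrite mxE; apply/eqP; rewrite -normr_eq0 eq_le normr_ge0.
by rewrite -x0 coord_le_enorm.
Qed.

Lemma enorm0 : enorm (0 : 'rV[R]_N) = 0.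
Proof. by apply/eqP; rewrite enorm_eq0. Qed.

Lemma enorm_gt0 x : (0 < enorm x) = (x != 0).
Proof. by rewrite lt_def enorm_eq0 enorm_ge0 andbT. Qed.

Lemma enormZ r x : enorm (r *: x) = `|r| * enorm x.
Proof.
rewrite /enorm -sqrtr_sqr -sqrtrM ?sqr_ge0//; congr Num.sqrt.
by rewrite mulr_sumr; apply: eq_bigr => i _; rewrite mxE exprMn.
Qed.

Lemma enorm_delta i : enorm (delta_mx 0 i : 'rV[R]_N) = 1.
Proof.
rewrite /enorm (bigD1 i)//= big1 ?mxE ?eqxx ?expr1n ?addr0 ?sqrtr1// => j ji.
by rewrite mxE (negbTE ji) andbF expr0n.
Qed.

Lemma is_derive_coord x i j :
  is_derive x (delta_mx 0 i) (fun y : 'rV[R]_N => y 0 j) ((i == j)%:R).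
Proof.
apply/is_derive_line0.
rewrite [X in is_derive _ _ X](_ : _ = (fun t : R => (i == j)%:R * t + x 0 j)).
  apply: (is_derive_eq (is_deriveD (is_derive_scale _ (is_derive_id (0:R) (1:R)))
            (is_derive_cst (x 0 j) (0:R) (1:R)))).
  by rewrite mulr1 addr0.
by apply/funext => t; rewrite !mxE eqxx/= eq_sym mulrC.
Qed.

Lemma is_derive_enorm_sqr x i :
  is_derive x (delta_mx 0 i) (fun y : 'rV[R]_N => \sum_(j < N) y 0 j ^+ 2) (2 * x 0 i).
Proof.
rewrite [X in is_derive _ _ X](_ : _ = \sum_(j < N) (fun y : 'rV[R]_N => y 0 j * y 0 j)).
  have dj j := is_derive_mul (is_derive_coord x i j) (is_derive_coord x i j).
  apply: (is_derive_eq (is_derive_sum dj)).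
  rewrite (bigD1 i)//= eqxx big1 => [|j ji]; last by rewrite eq_sym (negbTE ji) mul0r mulr0 addr0.
  by rewrite addr0 mul1r mulr1 mulr2n mulrDl mul1r.
by apply/funext => y; rewrite fct_sumE; apply: eq_bigr => j _; rewrite expr2.
Qed.

Lemma is_derive_enorm x i : x != 0 ->
  is_derive x (delta_mx 0 i) (@enorm R N) (x 0 i / enorm x).
Proof.
move=> x0; have xpos : 0 < enorm x by rewrite enorm_gt0.
have qpos : 0 < \sum_(j < N) x 0 j ^+ 2 by rewrite -enorm_sqr exprn_gt0.
apply: (is_derive_eq (is_derive_compl (is_derive1_sqrt qpos) (is_derive_enorm_sqr x i))).
by rewrite -/(enorm x); field; rewrite gt_eqF.
Qed.

Lemma enorm_continuous : continuous (@enorm R N).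
Proof.
have cq : continuous (fun y : 'rV[R]_N => \sum_(i < N) y 0 i ^+ 2).
  apply: continuous_big => [|i _ y]; first exact: add_continuous.
  apply: (@continuous_comp _ _ _ (fun y : 'rV[R]_N => y 0 i) (fun r : R => r ^+ 2)).
    exact: coord_continuous.
  exact: exprn_continuous.
by move=> x; apply: continuous_comp (cq x) _; exact: sqrt_continuous.
Qed.

Lemma near_enorm_itv x (a b : R) : a < enorm x < b -> \near x, a < enorm x < b.
Proof.
move=> /andP[ax xb]; near=> y; apply/andP; split; near: y.
  exact: (cvgr_gt (enorm x) (@enorm_continuous x) _ ax).
exact: (cvgr_lt (enorm x) (@enorm_continuous x) _ xb).
Unshelve. all: by end_near. Qed.

Lemma open_unit_ball : open (@unit_ball R N).
Proof.
rewrite openE => x x1; have := @near_enorm_itv x (-1) 1.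
rewrite (lt_le_trans (ltrN10 R) (enorm_ge0 x)) => /(_ x1).
by apply: filterS => y /andP[].
Qed.

Lemma punctured_ballP x : (@unit_ball R N `\ 0) x <-> 0 < enorm x < 1.
Proof.
split=> [[x1 x0]|/andP[x0 x1]].
  by apply/andP; split => //; rewrite enorm_gt0; apply/eqP.
by split=> // x0E; move: x0; rewrite x0E enorm0 ltxx.
Qed.

Lemma open_punctured_ball : open (@unit_ball R N `\ 0).
Proof.
rewrite openE => x /punctured_ballP/near_enorm_itv.
by apply: filterS => y /punctured_ballP.
Qed.

End EuclideanNorm.

Section RadialRegularity.
Context {R : realType} {N : nat}.
Implicit Types (x y : 'rV[R]_N) (i j : 'I_N) (U : set 'rV[R]_N).

(** The derivatives given by [partial] are limits chosen as values of a total
    operator; this passes from candidate first and second derivatives to the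
    regularity class. *)
Lemma C2_on_of_is_derive U (u : 'rV[R]_N -> R) (g : 'I_N -> 'rV[R]_N -> R)
    (H : 'I_N -> 'I_N -> 'rV[R]_N -> R) : open U ->
  (forall x i, U x -> is_derive x (delta_mx 0 i) u (g i x)) ->
  (forall x i j, U x -> is_derive x (delta_mx 0 j) (g i) (H i j x)) ->
  (forall x i, U x -> {for x, continuous (g i)}) ->
  (forall x i j, U x -> {for x, continuous (H i j)}) ->
  C2_on U u /\ forall x, U x -> laplacian u x = \sum_i H i i x.
Proof.
move=> oU ug gH cg cH.
have nearU x : U x -> \near x, U x by move=> Ux; exact: open_nbhs_nbhs.
have pE x i : U x -> partial i u x = g i x.
  by move=> Ux; have [_] := ug x i Ux.
have npE x i : U x -> \near x, g i x = partial i u x.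
  by move=> /nearU; apply: filterS => y Uy; rewrite pE.
have dp x i j : U x -> is_derive x (delta_mx 0 j) (partial i u) (H i j x).
  by move=> Ux; apply: near_eq_is_derive (npE x i Ux) _; exact: gH.
have ppE x i j : U x -> partial j (partial i u) x = H i j x.
  by move=> Ux; have [_] := dp x i j Ux.
split; [split|].
- move=> x i Ux; split; first by have [] := ug x i Ux.
  by apply: near_eq_continuous (cg x i Ux); exact: npE.
- move=> i x j Ux; split; first by have [] := dp x i j Ux.
  apply: near_eq_continuous (cH x i j Ux).
  by apply: filterS (nearU _ Ux) => y Uy; rewrite ppE.
- by move=> x Ux; apply: eq_bigr => i _; rewrite ppE.
Qed.

Context (h a phi : R -> R) (hprofile : radial_profile N h a phi).

Definition radial_grad i x := - (a (enorm x) * x 0 i).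
(** At the origin the quotient is 0 / 0 = 0, and the formula gives - a(0) times
    the identity, which is the Hessian there when phi(0) = N a(0). *)
Definition radial_hess i j x := - (a (enorm x) * (i == j)%:R
  + (phi (enorm x) - N%:R * a (enorm x)) * (x 0 i * x 0 j / enorm x ^+ 2)).

Local Notation u := (fun x => h (enorm x)).
Local Notation g := radial_grad.
Local Notation H := radial_hess.

Lemma is_derive_radial x i : 0 < enorm x < 1 -> is_derive x (delta_mx 0 i) u (g i x).
Proof.
move=> /[dup] x01 /andP[x0 x1]; have [dh _] := hprofile x01.
have xn0 : x != 0 by rewrite -enorm_gt0.
apply: (is_derive_eq (is_derive_compl dh (is_derive_enorm i xn0))).
by rewrite /radial_grad; field; rewrite gt_eqF.
Qed.

Lemma is_derive_radial_grad x i j :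
  0 < enorm x < 1 -> is_derive x (delta_mx 0 j) (g i) (H i j x).
Proof.
move=> /[dup] x01 /andP[x0 x1]; have [_ da] := hprofile x01.
have xn0 : x != 0 by rewrite -enorm_gt0.
have da' := is_derive_compl da (is_derive_enorm j xn0).
apply: (is_derive_eq (is_deriveN (is_derive_mul da' (is_derive_coord x j i)))).
rewrite /radial_hess /= eq_sym; move: (i == j)%:R => d.
by field; rewrite gt_eqF.
Qed.

Lemma radial_hess_trace x : x != 0 -> \sum_i H i i x = - phi (enorm x).
Proof.
move=> x0; have xpos : 0 < enorm x by rewrite enorm_gt0.
rewrite /radial_hess sumrN big_split/=; congr (- _).
under eq_bigr do rewrite eqxx mulr1.
rewrite sumr_const card_ord -mulr_sumr -mulr_suml.
under [X in _ * (X / _)]eq_bigr do rewrite -expr2.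
rewrite -enorm_sqr divff ?mulr1 ?expf_neq0 ?gt_eqF//.
by rewrite mulr_natl addrC subrK.
Qed.

Lemma radial_grad_continuous x i :
  {for x, continuous (a \o (@enorm R N))} -> {for x, continuous (g i)}.
Proof.
by move=> ca; apply: continuous_at_opp; apply: continuous_at_mul => //; exact: coord_continuous.
Qed.

Lemma profile_slope_continuous x : 0 < enorm x < 1 -> {for x, continuous (a \o (@enorm R N))}.
Proof.
move=> x01; apply: continuous_comp; first exact: enorm_continuous.
by have [_] := hprofile x01; exact: is_derive_continuous.
Qed.

Lemma radial_hess_continuous x i j : 0 < enorm x < 1 ->
  {for x, continuous (phi \o (@enorm R N))} ->
  {for x, continuous (H i j)}.
Proof.
move=> x01 cphi; have ca := profile_slope_continuous x01.
apply: continuous_at_opp; apply: continuous_at_add; apply: continuous_at_mul => //.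
- exact: continuous_at_cst.
- by apply: continuous_at_sub => //; apply: continuous_at_mul => //; exact: continuous_at_cst.
- apply: continuous_at_mul; first by apply: continuous_at_mul; exact: coord_continuous.
  apply: continuous_at_inv; first by rewrite expf_neq0// gt_eqF//; case/andP: x01.
  apply: (@continuous_comp _ _ _ (@enorm R N) (fun r : R => r ^+ 2)).
    exact: enorm_continuous.
  exact: exprn_continuous.
Qed.

Lemma radial_C2_punctured :
  (forall x, 0 < enorm x < 1 -> {for x, continuous (phi \o (@enorm R N))}) ->
  C2_on (unit_ball N `\ 0) u /\
  forall x, 0 < enorm x < 1 -> - laplacian u x = phi (enorm x).
Proof.
move=> cphi.
have [||||C2u lapu] := @C2_on_of_is_derive (unit_ball N `\ 0) u g H open_punctured_ball.
- by move=> x i /punctured_ballP/is_derive_radial.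
- by move=> x i j /punctured_ballP/is_derive_radial_grad.
- by move=> x i /punctured_ballP/profile_slope_continuous/radial_grad_continuous.
- by move=> x i j /punctured_ballP x01; apply: radial_hess_continuous => //; exact: cphi.
split => // x x01; rewrite lapu; last exact/punctured_ballP.
by rewrite radial_hess_trace ?opprK// -enorm_gt0; case/andP: x01.
Qed.

(** Integrates h' = - r a, where a is bounded near the origin. *)
Lemma radial_quadratic_near0 : a r @[r --> 0^'+] --> a 0 -> h r @[r --> 0^'+] --> h 0 ->
  exists C : R, \forall r \near (0 : R), `|h `|r| - h 0| <= C * r ^+ 2.
Proof.
move=> /cvgrPdist_lt/(_ 1 ltr01) a1 ch; exists (`|a 0| + 1).
have [d d0 dP] : exists2 d : R, 0 < d & forall r, 0 < r < d -> `|a r| <= `|a 0| + 1.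
  move: a1; rewrite near_withinE => /nbhs_ballP[d d0 dP]; exists d => // r /andP[r0 rd].
  have := dP r; rewrite /ball/= sub0r normrN gtr0_norm// => /(_ rd r0) /ltW.
  move=> ard; rewrite -lerBlDl; apply: le_trans ard.
  by rewrite distrC lerB_dist.
near=> r0; rewrite -(normr0 R) -[r0 ^+ 2]real_normK ?num_real//.
have rd : `|r0| < Num.min d 1.
  near: r0; have /cvgr0Pnorm_lt : id t @[t --> (0:R)] --> (0 : R) by exact: cvg_id.
  by apply; rewrite lt_min d0 ltr01.
move: (normr_ge0 r0) rd; move: `|r0| => r; rewrite normr0 le_eqVlt => /predU1P[<- _|].
  by rewrite subrr normr0 expr0n mulr0.
move=> r0'; rewrite lt_min => /andP[rd r1].
have cr : {within `[0, r], continuous h}.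
  apply/continuous_within_itvP => //; split=> //.
    move=> t; rewrite in_itv/= => /andP[t0 tr].
    have [|dh _] := @hprofile t; first by rewrite t0 (lt_trans tr).
    exact: is_derive_continuous dh.
  have [|dh _] := @hprofile r; first by rewrite r0' r1.
  by apply: cvg_at_left_filter; exact: is_derive_continuous dh.
have dht t : 0 < t < r -> is_derive t 1 h (- (t * a t)).
  by move=> /andP[t0 tr]; have [|] := @hprofile t; first by rewrite t0 (lt_trans tr).
have aC t : 0 < t < r -> `|t * a t| <= (`|a 0| + 1) * r.
  move=> /andP[t0 tr]; rewrite normrM mulrC (gtr0_norm t0).
  by apply: ler_pM; rewrite ?(ltW t0) ?(ltW tr)// dP// t0 (lt_trans tr).
rewrite expr2 mulrA -[X in _ * X]subr0.
apply: (@norm_sub_le_of_derive _ h (fun t => - (t * a t))) => //; first exact: ltW.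
by move=> t /aC; rewrite normrN.
Unshelve. all: by end_near. Qed.

(** At the origin the coefficient of the unbounded but homogeneous of degree 0
    part of the Hessian, phi - N a, vanishes, so that the second derivatives
    extend continuously. *)
Lemma radial_C2 :
  (forall x, 0 < enorm x < 1 -> {for x, continuous (phi \o (@enorm R N))}) ->
  phi r @[r --> 0^'+] --> phi 0 -> a r @[r --> 0^'+] --> a 0 ->
  h r @[r --> 0^'+] --> h 0 -> phi 0 = N%:R * a 0 ->
  C2_on (unit_ball N) u /\
  forall x, unit_ball N x -> - laplacian u x = phi (enorm x).
Proof.
move=> cphi phi_cvg a_cvg h_cvg phi0.
have cases x : unit_ball N x -> x = 0 \/ 0 < enorm x < 1.
  rewrite /unit_ball/= => x1; have [->|x0] := eqVneq x 0; [by left|right].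
  by rewrite enorm_gt0 x0.
have ca : {for 0, continuous (a \o (@enorm R N))}.
  by apply: continuous_at_right0 => //; [exact: enorm0|exact: enorm_ge0|exact: enorm_continuous].
have cphi0 : {for 0, continuous (phi \o (@enorm R N))}.
  by apply: continuous_at_right0 => //; [exact: enorm0|exact: enorm_ge0|exact: enorm_continuous].
have g0 i : g i 0 = 0 by rewrite /radial_grad mxE mulr0 oppr0.
have H0 i j : H i j 0 = - (a 0 * (i == j)%:R).
  by rewrite /radial_hess enorm0 phi0 subrr mul0r addr0.
have [||||C2u lapu] := @C2_on_of_is_derive (unit_ball N) u g H open_unit_ball.
- move=> x i /cases[->|/is_derive_radial//]; rewrite g0; apply/is_derive_line0.
  have [C nearC] := radial_quadratic_near0 a_cvg h_cvg.
  rewrite [X in is_derive _ _ X](_ : _ = (fun t : R => h `|t|)); last first.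
    by apply/funext => t; rewrite addr0 enormZ enorm_delta mulr1.
  apply: (@is_derive_quadratic0 _ _ C).
  by apply: filterS nearC => t; rewrite normr0.
- move=> x i j /cases[->|/is_derive_radial_grad//]; rewrite H0; apply/is_derive_line0.
  rewrite [X in is_derive _ _ X](_ : _ = (fun t : R => t * - (a `|t| * (i == j)%:R))); last first.
    apply/funext => t; rewrite /radial_grad addr0 enormZ enorm_delta mulr1 !mxE eqxx/=.
    by rewrite mulrN mulrCA mulrA.
  have /is_derive_id_mul0 : {for 0, continuous (fun t : R => - (a `|t| * (i == j)%:R))}.
    apply: continuous_at_opp; apply: continuous_at_mul; last exact: continuous_at_cst.
    apply: continuous_at_right0 => //; [exact: normr0|exact: norm_continuous].
  by rewrite normr0.
- by move=> x i /cases[->|/profile_slope_continuous]; exact: radial_grad_continuous.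
- move=> x i j /cases[->|x01]; last by apply: radial_hess_continuous => //; exact: cphi.
  apply: continuous_at_opp; apply: continuous_at_add.
    by apply: continuous_at_mul => //; exact: continuous_at_cst.
  apply: continuous_at_mul_bounded.
  + by apply: continuous_at_sub => //; apply: continuous_at_mul => //; exact: continuous_at_cst.
  + by rewrite enorm0 phi0 subrr.
  + move=> y; have [->|y0] := eqVneq y 0; first by rewrite enorm0 expr0n invr0 mulr0 normr0.
    have ypos : 0 < enorm y by rewrite enorm_gt0.
    rewrite normrM normfV (ger0_norm (exprn_ge0 2 (enorm_ge0 y))) ler_pdivrMr ?exprn_gt0//.
    by rewrite mul1r normrM expr2; apply: ler_pM => //; exact: coord_le_enorm.
split => // x x1; rewrite lapu//.
have [->|x0] := eqVneq x 0; last by rewrite radial_hess_trace ?opprK.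
under eq_bigr do rewrite H0 eqxx mulr1.
by rewrite sumr_const card_ord enorm0 phi0 mulNrn opprK mulr_natl.
Qed.

End RadialRegularity.

(** * The maximum principle off the origin *)

Section SecondDerivative.
Context {R : realType}.

(** Second order necessary condition. If the second derivative were negative,
    the first one would be negative just to the right of the minimum. *)
Lemma second_derivative_min_ge0 (f df : R -> R) (d : R) :
  (\forall t \near (0 : R), is_derive (t : R) 1 f (df t)) -> is_derive (0 : R) 1 df d ->
  (\forall t \near (0 : R), f 0 <= f t) -> 0 <= d.
Proof.
move=> fdf dfd fmin.
have [e e0 eP] : exists2 e : R, 0 < e & forall t, - e < t < e ->
    is_derive t 1 f (df t) /\ f 0 <= f t.
  have : nbhs (0 : R) (fun t : R => is_derive t 1 f (df t) /\ f 0 <= f t).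
    exact: filterI fdf fmin.
  move=> /nbhs_ballP[e e0 eP]; exists e => // t te.
  by apply: eP; rewrite /ball/= sub0r normrN ltr_norml.
have df0 : df 0 = 0.
  have d0 : is_derive (0:R) 1 f 0.
    apply: (@derive1_at_min _ f (- e) e 0).
    - by lra.
    - by move=> t; rewrite in_itv => /eP[[]].
    - by rewrite in_itv/=; apply/andP; split; lra.
    - by move=> t; rewrite in_itv => /eP[].
  have [| [_ <-] _] := eP 0; first by apply/andP; split; lra.
  by have [_] := d0.
rewrite leNgt; apply/negP => dneg.
have /is_derive1_caratheodory[q [qE cq q0]] := dfd.
have qneg : \forall t \near (0 : R), q t < 0.
  by apply: (cvgr_lt _ cq); rewrite q0.
have [c [c0 ce cq0]] : exists c : R, [/\ 0 < c, c < e & forall t, 0 < t < c -> q t < 0].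
  have /nbhs_ballP[c c0 cP] := qneg; exists (Num.min c e / 2).
  have m0 : 0 < Num.min c e by rewrite lt_min c0.
  have mc : Num.min c e <= c by rewrite ge_min lexx.
  have me : Num.min c e <= e by rewrite ge_min lexx orbT.
  split; [by rewrite divr_gt0| by lra|].
  move=> t /andP[t0 tc]; apply: cP; rewrite /ball/= sub0r normrN gtr0_norm//; lra.
have te t : 0 <= t <= c -> - e < t < e by move=> /andP[t0 tc]; apply/andP; split; lra.
have dft t : 0 <= t <= c -> is_derive t 1 f (df t) by move=> /te/eP[].
have fc : f 0 <= f c by have [|_] := eP c; first by apply/andP; split; lra.
have [t tc fE] := MVT c0 (fun t tc => dft t (subset_itv_oo_cc tc)) (within_of_derive dft).
have /andP[t0 tc'] : 0 < t < c by move: tc; rewrite in_itv.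
have dft0 : df t < 0.
  have := qE t; rewrite df0 !subr0 => ->.
  by rewrite pmulr_llt0// cq0// t0.
have : f c - f 0 < 0 by rewrite fE subr0 pmulr_llt0.
by lra.
Qed.

End SecondDerivative.

Section MaximumPrinciple.
Context {R : realType} {N : nat}.
Implicit Types (x y : 'rV[R]_N) (w : 'rV[R]_N -> R) (r : R).

Lemma compact_annulus (s : R) : compact [set x : 'rV[R]_N | s <= enorm x <= 1].
Proof.
apply: bounded_closed_compact.
  exists 1; split; first exact: num_real.
  move=> c c1 x /= /andP[_ x1]; apply: le_trans (ltW c1).
  rewrite /Num.norm/= mx_normrE; apply: bigmax_le => // -[i j] _ /=.
  by rewrite ord1; apply: le_trans (coord_le_enorm _ _) x1.
have -> : [set x : 'rV[R]_N | s <= enorm x <= 1] = @enorm R N @^-1` `[s, 1].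
  by apply/seteqP; split => x /=; rewrite in_itv.
apply: preimage_closed; first by move=> x _; exact: enorm_continuous.
exact: interval_closed.
Qed.

(** The barrier 1 - r ^ 2 - 2 ln r is nonnegative on (0, 1], tends to infinity
    at the origin, and is strictly superharmonic as soon as N >= 2. *)
Lemma log_barrier_profile : radial_profile N (fun r : R => 1 - r ^+ 2 - 2 * ln r)
  (fun r => 2 + 2 / r ^+ 2) (fun r => 2 * N%:R + 2 * (N%:R - 2) / r ^+ 2).
Proof.
move=> r /andP[r0 r1]; have rn0 : r != 0 by rewrite gt_eqF.
have rn2 : r ^+ 2 != 0 by rewrite expf_neq0.
have d1 : is_derive r 1 (fun=> 1 : R) 0 by exact: is_derive_cst.
have d2 : is_derive r 1 (fun=> 2 : R) 0 by exact: is_derive_cst.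
split.
  apply: (is_derive_eq (is_deriveB (is_deriveB d1 (is_derive_pow 2 r))
    (is_derive_scale 2 (is_derive1_ln r0)))).
  by field.
apply: (is_derive_eq (is_deriveD d2 (is_derive_scale 2
  (@is_derive_inv _ (fun t => t ^+ 2) _ _ rn2 (is_derive_pow 2 r))))).
by rewrite expr1; field.
Qed.

Lemma second_partial_min_ge0 w x (i : 'I_N) (g : 'rV[R]_N -> R) (d : R) :
  (\forall y \near x, is_derive (y : 'rV[R]_N) (delta_mx 0 i) w (g y)) ->
  is_derive x (delta_mx 0 i) g d ->
  (\forall y \near x, w x <= w y) -> 0 <= d.
Proof.
move=> wg gd wmin.
have line := @line_cvg _ _ (delta_mx 0 i : 'rV[R]_N) x.
apply: (@second_derivative_min_ge0 _ (fun t => w (t *: delta_mx 0 i + x))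
   (fun t => g (t *: delta_mx 0 i + x))).
- have := line _ wg; rewrite nbhs_simpl/=; apply: filterS => t.
  exact: (is_derive_line w x (delta_mx 0 i) t _).1.
- exact: (is_derive_line0 g x (delta_mx 0 i) d).1.
- rewrite scale0r add0r.
  by have := line _ wmin; rewrite nbhs_simpl.
Qed.

(** A point is removable in dimension at least 2. Adding a small multiple of
    [log_barrier_profile] to w - h(|x|) pushes a negative minimum away from the
    origin, hence into the interior of a compact annulus, and makes the
    Laplacian of the difference strictly negative there, which the second order
    condition forbids. *)
Lemma radial_maximum_principle w (h a phi : R -> R) (C : R) : (2 <= N)%N ->
  {within unit_cball N, continuous w} -> C2_on (unit_ball N `\ 0) w ->
  (forall x, enorm x <= 1 -> 0 <= w x) ->
  radial_profile N h a phi ->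
  (forall r, 0 < r <= 1 -> {for r, continuous h}) ->
  (forall r, 0 < r <= 1 -> h r <= C) -> h 1 = 0 ->
  (forall x, 0 < enorm x < 1 -> phi (enorm x) <= - laplacian w x) ->
  forall x, 0 < enorm x <= 1 -> h (enorm x) <= w x.
Proof.
move=> N2 cw C2w w0 Hh ch hC h1 phiw x1 /[dup] x1P /andP[x10 x11].
rewrite leNgt; apply/negP => wh.
pose b (r : R) : R := 1 - r ^+ 2 - 2 * ln r.
have b0 r : 0 < r <= 1 -> 0 <= b r.
  move=> /andP[r0 r1]; rewrite /b.
  have l0 : ln r <= 0 by rewrite ln_le0.
  have : r ^+ 2 <= 1 by rewrite expr_le1// ltW.
  lra.
(* Small enough for the perturbed difference to stay negative at x1, where the
   comparison is supposed to fail. *)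
pose eta := (h (enorm x1) - w x1) / (2 * (b (enorm x1) + 1)).
have bx := b0 _ x1P.
have eta0 : 0 < eta by rewrite divr_gt0 ?subr_gt0//; lra.
pose k r := h r - eta * b r.
pose ka r := a r - eta * (2 + 2 / r ^+ 2).
pose kphi r := phi r - eta * (2 * N%:R + 2 * (N%:R - 2) / r ^+ 2).
have Hk : radial_profile N k ka kphi.
  move=> r r01; have [dh da] := Hh _ r01; have [db dba] := log_barrier_profile r01.
  have rn0 : r != 0 by case/andP: r01 => ? _; rewrite gt_eqF.
  split.
    by apply: (is_derive_eq (is_deriveB dh (is_derive_scale eta db))); rewrite /ka; field.
  by apply: (is_derive_eq (is_deriveB da (is_derive_scale eta dba))); rewrite /ka /kphi; field.
pose z x := w x - k (enorm x).
have zx1 : z x1 < 0.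
  have e1 : eta * (2 * (b (enorm x1) + 1)) = h (enorm x1) - w x1.
    by rewrite /eta divfK// gt_eqF//; lra.
  have : eta * b (enorm x1) < h (enorm x1) - w x1.
    by rewrite -e1 ltr_pM2l//; lra.
  by rewrite /z /k; lra.
(* On the sphere of radius s the barrier exceeds the upper bound C of h. *)
have [s [s0 s1 zs]] : exists s : R, [/\ 0 < s, s < enorm x1 & C < eta * b s].
  pose c := expR (- ((`|C| + 1) / (2 * eta))).
  have c0 : 0 < c by exact: expR_gt0.
  exists (Num.min (enorm x1 / 2) c).
  have m0 : 0 < Num.min (enorm x1 / 2) c by rewrite lt_min divr_gt0.
  have m1 : Num.min (enorm x1 / 2) c <= enorm x1 / 2 by rewrite ge_min lexx.
  have mc : Num.min (enorm x1 / 2) c <= c by rewrite ge_min lexx orbT.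
  move: (Num.min _ _) m0 m1 mc => s s0 s1 sc; split=> //; first lra.
  have ln_s : ln s <= - ((`|C| + 1) / (2 * eta)) by rewrite -[leRHS]expRK ler_ln ?posrE.
  have s2 : s ^+ 2 <= 1 by rewrite expr_le1 ?(ltW s0)//; lra.
  have etab : `|C| + 1 <= eta * b s.
    have -> : `|C| + 1 = eta * (2 * ((`|C| + 1) / (2 * eta))) by field; rewrite gt_eqF.
    by rewrite ler_pM2l// /b; lra.
  by have := ler_norm C; lra.
pose K := [set x : 'rV[R]_N | s <= enorm x <= 1].
have K0 : K !=set0 by exists x1; rewrite /K/= (ltW s1).
have cz : {within K, continuous z}.
  have cw' : {within K, continuous w}.
    by apply: continuous_subspaceW cw => x /andP[].
  have ck : {within K, continuous (fun x => k (enorm x))}.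
    apply: continuous_in_subspaceT => x; rewrite inE => /andP[sx x1le].
    have xpos := lt_le_trans s0 sx.
    apply: continuous_comp; first exact: enorm_continuous.
    apply: (@continuous_at_sub _ _ h (fun r => eta * b r)); first by apply: ch; rewrite xpos.
    have d1 : is_derive (enorm x) 1 (fun=> 1 : R) 0 by exact: is_derive_cst.
    exact: is_derive_continuous (is_derive_scale eta (is_deriveB
      (is_deriveB d1 (is_derive_pow 2 _)) (is_derive_scale 2 (is_derive1_ln xpos)))).
  move=> x; exact: (@continuous_at_sub _ _ _ _ x (cw' x) (ck x)).
have [x0 x0K x0min] := EVT_min_rV K0 (@compact_annulus s) cz.
have zx0 : z x0 < 0.
  apply: le_lt_trans zx1; apply: x0min; rewrite inE.
  by rewrite /K/= (ltW s1).
move: x0K; rewrite inE /K/= => /andP[sx0 x0le1].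
have x00 : 0 < enorm x0 := lt_le_trans s0 sx0.
have x0lt1 : enorm x0 < 1.
  rewrite lt_neqAle x0le1 andbT; apply/eqP => x0E.
  move: zx0; rewrite /z /k x0E h1 /b ln1 expr1n subrr mulr0 subr0 mulr0 !subr0.
  by rewrite ltNge w0.
have sx0' : s < enorm x0.
  rewrite lt_neqAle sx0 andbT; apply/eqP => sE.
  move: zx0; rewrite /z /k -sE; have := w0 _ x0le1.
  have := hC s; rewrite s0 (le_trans (ltW s1)) => // /(_ isT); lra.
have x0P : 0 < enorm x0 < 1 by rewrite x00.
have hess i : 0 <= partial i (partial i w) x0 - radial_hess ka kphi i i x0.
  apply: (@second_partial_min_ge0 z x0 i (fun x => partial i w x - radial_grad ka i x)).
  - apply: filterS (near_enorm_itv x0P) => y yP.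
    have /punctured_ballP yU := yP; have [C1w _] := C2w.
    apply: is_deriveB; last exact: is_derive_radial Hk _ _ yP.
    by have [/derivableP] := C1w y i yU.
  - have /punctured_ballP x0U := x0P; have [_ C1w] := C2w.
    apply: is_deriveB; last exact: is_derive_radial_grad Hk _ _ _ x0P.
    by have [/derivableP] := C1w i x0 i x0U.
  - have x0sP : s < enorm x0 < 1 by rewrite sx0'.
    apply: filterS (near_enorm_itv x0sP) => y /andP[sy y1]; apply: x0min.
    by rewrite inE /K/= (ltW sy) (ltW y1).
have := phiw _ x0P; rewrite leNgt => /negP; apply.
have : 0 <= \sum_i (partial i (partial i w) x0 - radial_hess ka kphi i i x0).
  by apply: sumr_ge0 => i _; exact: hess.
rewrite sumrB -/(laplacian w x0) radial_hess_trace -?enorm_gt0// opprK /kphi.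
have : 0 < eta * (2 * N%:R + 2 * (N%:R - 2) / enorm x0 ^+ 2).
  rewrite mulr_gt0// ltr_pwDl ?mulr_gt0 ?ltr0n ?(leq_trans _ N2)//.
  by rewrite divr_ge0 ?exprn_ge0 ?(ltW x00)// mulr_ge0// subr_ge0 ler_nat.
lra.
Qed.

End MaximumPrinciple.

(** * Transplanting planar profiles to other dimensions *)

Section Composition.
Context {R : realType}.
Implicit Types (h a f g k dk : R -> R) (N : nat) (r : R).

(** The change of variables s = g(r) is described by its logarithmic derivative
    k = r g' / g. A planar profile h becomes in dimension N the profile h o g,
    whose source is the transplanted one plus a multiple of (N - 2) k + r k'
    and of the planar flux. This factor is 0 exactly when g maps the
    N-dimensional fundamental solution to a multiple of the planar one, and it
    is (N - 2) p for g = r ^ p. *)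
Lemma radial_profile_comp N h a f g k dk : radial_profile 2 h a f ->
  (forall r, 0 < r < 1 -> 0 < g r < 1) ->
  (forall r, 0 < r < 1 -> is_derive r 1 g (k r * g r / r)) ->
  (forall r, 0 < r < 1 -> is_derive r 1 k (dk r)) ->
  radial_profile N (h \o g) (fun r => k r * (g r ^+ 2 * a (g r)) / r ^+ 2)
    (fun r => (((N%:R - 2) * k r + r * dk r) * (g r ^+ 2 * a (g r))
               + k r ^+ 2 * g r ^+ 2 * f (g r)) / r ^+ 2).
Proof.
move=> H g01 dg dk' r r01; have [dh _] := H _ (g01 _ r01).
have rn0 : r != 0 by rewrite gt_eqF//; case/andP: r01.
split.
  by apply: (is_derive_eq (is_derive1_comp dh (dg _ r01))); field.
have dJ := @radial_profile_flux _ 2 _ _ _ _ isT H (g01 _ r01).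
have dJg := is_derive1_comp dJ (dg _ r01).
have rn2 : r ^+ 2 != 0 by rewrite expf_neq0.
have dinv := @is_derive_inv _ (fun t => t ^+ 2) _ _ rn2 (is_derive_pow 2 r).
apply: (is_derive_eq (is_derive_mul (is_derive_mul (dk' _ r01) dJg) dinv)).
by rewrite /= expr1; field.
Qed.

End Composition.

Section Comparison.
Context {R : realType} {aF : \bar R} {F : R -> R} (hF : nonlinearity aF F).
Implicit Types (r c M alpha lambda mu : R) (N : nat) (v h u g k dk : R -> R).

Lemma classical_solution_bound N alpha lambda (w : 'rV[R]_N -> R) :
  classical_solution aF F alpha lambda w ->
  exists M, [/\ 0 <= M, (M%:E < aF)%E & forall x, enorm x <= 1 -> 0 <= w x <= M].
Proof.
move=> [[_ _ wdom _ wbd] wsup].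
have ub x : enorm x < 1 -> (`|w x|%:E <= sup_norm (EFin \o w))%E.
  by move=> x1; apply: ereal_sup_ubound; exists x.
have S0 : (0 <= sup_norm (EFin \o w))%E.
  by apply: le_trans (ub 0 _); rewrite ?enorm0// lee_fin.
have Sfin : sup_norm (EFin \o w) \is a fin_num.
  by rewrite ge0_fin_numE// (lt_le_trans wsup)// leey.
have M0 : 0 <= fine (sup_norm (EFin \o w)) by rewrite fine_ge0.
exists (fine (sup_norm (EFin \o w))); rewrite fineK//; split=> // x.
rewrite le_eqVlt => /predU1P[x1|x1]; first by rewrite wbd// lexx.
have [w0 _] := wdom x x1; rewrite w0/= -lee_fin fineK//.
by have := ub _ x1; rewrite ger0_norm.
Qed.

(** Barriers are only available at positive radii; continuity takes care of the
    origin. *)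
Lemma poisson_le_of_pos N phi h M : radial_poisson N phi h ->
  (forall r, 0 < r <= 1 -> h r <= M) -> forall r, h r <= M.
Proof.
move=> [a [_ _ _ [ch _ hc]]] hM r; rewrite -hc.
have := clamp_bounds r; move: (clamp r) => {}r /andP[+ r1].
rewrite le_eqVlt => /predU1P[<-|r0]; last by apply: hM; rewrite r0.
have c0 : h s @[s --> 0^'+] --> h 0 by apply: cvg_at_right_filter; exact: ch.
rewrite -(cvg_lim _ c0)//; apply: limr_le; first by apply/cvg_ex; eexists; exact: c0.
near=> s; apply: hM; apply/andP; split.
  by near: s; exact: nbhs_right_gt.
by near: s; exact: nbhs_right_le.
Unshelve. all: by end_near. Qed.

Lemma poisson_bounded N phi h : radial_poisson N phi h ->
  exists C, forall r, 0 < r <= 1 -> h r <= C.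
Proof.
move=> [a [_ _ _ [ch _ _]]].
have [c _ cP] := @EVT_max _ h 0 1 ler01 (continuous_subspaceT ch).
by exists (h c) => r /andP[r0 r1]; apply: cP; rewrite in_itv/= (ltW r0).
Qed.

Lemma source_planar mu v r : source F 0 mu v r = mu * F (v r).
Proof. by rewrite /source powRr0 mulr1. Qed.

Definition radial_change g k dk := [/\
  forall r, 0 < r < 1 -> [/\ 0 < g r < 1, is_derive r 1 g (k r * g r / r) & is_derive r 1 k (dk r)],
  forall r, 0 < r <= 1 -> {for r, continuous g} &
  g 1 = 1].

Lemma radial_change_itv g k dk r : radial_change g k dk -> 0 < r <= 1 -> 0 < g r <= 1.
Proof.
move=> [gd _ g1] /andP[r0]; rewrite le_eqVlt => /predU1P[->|r1].
  by rewrite g1 ltr01 lexx.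
by have [|/andP[-> /ltW ->]] := gd r; rewrite ?r0.
Qed.

Lemma radial_change_profile N h a f g k dk : radial_change g k dk ->
  radial_profile 2 h a f ->
  radial_profile N (h \o g) (fun r => k r * (g r ^+ 2 * a (g r)) / r ^+ 2)
    (fun r => (((N%:R - 2) * k r + r * dk r) * (g r ^+ 2 * a (g r))
               + k r ^+ 2 * g r ^+ 2 * f (g r)) / r ^+ 2).
Proof.
move=> [gd _ _] H; apply: (@radial_profile_comp _ N h a f g k dk H) => r r01.
- by have [] := gd r r01.
- by have [] := gd r r01.
- by have [] := gd r r01.
Qed.

(** From a classical solution in dimension N >= 2, radial or not, to a planar
    radial one. The change of variables is chosen so that the transplanted
    planar functions are exact potentials of their transplanted sources; if
    those sources are dominated by lambda r ^ alpha F, the solution w is a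
    barrier for the planar fixed point problem, by the maximum principle. *)
Lemma planar_solution_below N alpha lambda mu (w : 'rV[R]_N -> R) g k dk :
  (2 <= N)%N -> classical_solution aF F alpha lambda w -> radial_change g k dk ->
  (forall s, 0 < s <= 1 -> exists2 r, 0 < r <= 1 & g r = s) ->
  0 <= mu -> 0 <= lambda ->
  (forall r, 0 < r < 1 -> (N%:R - 2) * k r + r * dk r = 0) ->
  (forall r, 0 < r < 1 -> mu * (k r ^+ 2 * g r ^+ 2) / r ^+ 2 <= lambda * r `^ alpha) ->
  exists u, radial_solution aF F 2 0 mu u /\
    forall x : 'rV[R]_N, 0 < enorm x <= 1 -> u (g (enorm x)) <= w x.
Proof.
move=> N2 wsol gk gsurj mu0 lambda0 kdk gle.
have [M [M0 MaF wM]] := classical_solution_bound wsol.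
have [gd cg g1] := gk.
pose B r c := exists x : 'rV[R]_N, [/\ 0 < enorm x <= 1, r = g (enorm x) & c = w x].
have [|v h cv vM vB hv|u [usol _ uB]] :=
    @fixpoint_below _ _ _ hF 2 0 mu M B isT (lexx 0) mu0 M0 MaF.
- by move=> r c [x [/andP[_ x1] _ ->]]; case/andP: (wM _ x1).
- have hw x : 0 < enorm x <= 1 -> h (g (enorm x)) <= w x.
    have [C hC] := poisson_bounded hv.
    have [a [Hh _ _ [ch h1 hc]]] := hv.
    have [[cw [C2w _] wdom weq wbd] _] := wsol.
    have sub (y : 'rV[R]_N) : 0 < enorm y < 1 -> weight_region N alpha y.
      by move=> /punctured_ballP yU; rewrite /weight_region; case: ifP => // _; case: yU.
    move: x; apply: (radial_maximum_principle (C := C) N2 cw _ _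
      (radial_change_profile N gk Hh)).
    + have [C1w C2w'] := C2w.
      split=> [y i /punctured_ballP/sub yU|i y j /punctured_ballP/sub yU]; first exact: C1w.
      exact: C2w'.
    + by move=> y y1; case/andP: (wM y y1).
    + by move=> r r01; apply: continuous_comp; [exact: cg|exact: ch].
    + by move=> r r01; apply: hC; exact: radial_change_itv gk r01.
    + by rewrite /= g1.
    + move=> y y01; rewrite weq; last exact: sub.
      have /andP[y0 y1] := y01.
      rewrite kdk// mul0r add0r source_planar.
      have y01' : 0 < enorm y <= 1 by rewrite y0 ltW.
      have Fv : F (v (g (enorm y))) <= F (w y).
        apply: (nonlinearity_le hF); first by case/andP: (vM (g (enorm y))).
          by apply: vB; exists y.
        exact: wdom.
      have Fv0 : 0 <= F (v (g (enorm y))).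
        apply: le_trans (nonlinearity_ge1 hF _); rewrite ?ler01//.
        apply: (nl_domain_le _ _ (wdom y y1)); first by case/andP: (vM (g (enorm y))).
        by apply: vB; exists y.
      have := gle _ y01 => gley.
      apply: (@le_trans _ _ (lambda * enorm y `^ alpha * F (v (g (enorm y))))).
        rewrite [leLHS](_ : _ = mu * (k (enorm y) ^+ 2 * g (enorm y) ^+ 2) / enorm y ^+ 2
            * F (v (g (enorm y)))).
          by rewrite ler_wpM2r.
        by field; rewrite gt_eqF.
      by rewrite ler_wpM2l// mulr_ge0// powR_ge0.
  split; last by move=> r c [x [x01 -> ->]]; exact: hw.
  apply: (poisson_le_of_pos hv) => s /gsurj[r r01 <-].
  have i0 : 'I_N := Ordinal (leq_trans (isT : (0 < 2)%N) N2).
  have xr : enorm (r *: delta_mx 0 i0 : 'rV[R]_N) = r.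
    by rewrite enormZ enorm_delta mulr1 gtr0_norm//; case/andP: r01.
  have := hw (r *: delta_mx 0 i0); rewrite xr => /(_ r01)/le_trans; apply.
  have x1 : enorm (r *: delta_mx 0 i0 : 'rV[R]_N) <= 1 by rewrite xr; case/andP: r01.
  by case/andP: (wM _ x1).
exists u; split=> // x x01; apply: uB; by exists x.
Qed.

(** In the opposite direction all functions are radial, and the transplanted
    planar solution u o g is a barrier for the problem in dimension N, by
    comparison of fluxes. Here the extra term of [radial_profile_comp] only
    needs a sign. *)
Lemma radial_solution_of_planar N alpha lambda mu u g k dk :
  (0 < N)%N -> 0 <= alpha -> 0 <= lambda -> radial_solution aF F 2 0 mu u -> 0 <= mu ->
  radial_change g k dk -> (forall r, 0 < r < 1 -> 0 <= k r) ->
  (forall r, 0 < r < 1 -> 0 <= (N%:R - 2) * k r + r * dk r) ->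
  (forall r, 0 < r < 1 -> lambda * r `^ alpha <= mu * (k r ^+ 2 * g r ^+ 2) / r ^+ 2) ->
  exists u', radial_solution aF F N alpha lambda u'.
Proof.
move=> N0 alpha0 lambda0 [up [M [MaF M0 uM]]] mu0 gk k0 kdk gle.
have [gd cg g1] := gk.
have udom r : nl_domain aF (u r).
  by have /andP[u0 u1] := uM r; exact: (nl_domain_le u0 u1).
pose B r c := 0 < r <= 1 /\ c = u (g r).
have [|v h cv vM vB hv|u' [u'sol _ _]] :=
    @fixpoint_below _ _ _ hF N alpha lambda M B N0 alpha0 lambda0 M0 MaF.
- by move=> r c [_ ->]; case/andP: (uM (g r)).
- have hu r : 0 < r <= 1 -> h r <= u (g r).
    have [a [Hu ca _ [cu u1 uc]]] := up.
    have [b [Hh cb _ [ch h1 hc]]] := hv.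
    have cug : {within `]0, 1], continuous (u \o g)}.
      apply: continuous_in_subspaceT => s; rewrite inE/= in_itv/= => s01.
      by apply: continuous_comp; [exact: cg|exact: cu].
    have a0 s : 0 < s < 1 -> 0 <= a s.
      apply: (radial_poisson_ge0 _ Hu ca) => // t _.
      rewrite source_planar mulr_ge0//.
      by apply: le_trans (nonlinearity_ge1 hF (udom t)).
    apply: (profile_comparison N0 Hh (radial_change_profile N gk Hu)) => //.
    + move=> s s01; have [gs _ _] := gd _ s01; have /andP[s0 s1] := s01.
      have s01' : 0 < s <= 1 by rewrite s0 ltW.
      rewrite source_planar /source clamp_id; last by rewrite !ltW.
      apply: (@le_trans _ _ (lambda * s `^ alpha * F (u (g s)))).
        rewrite ler_wpM2l ?mulr_ge0 ?powR_ge0//.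
        apply: (nonlinearity_le hF) => //; first by case/andP: (vM s).
        by apply: vB.
      have Fu0 : 0 <= F (u (g s)) by apply: le_trans (nonlinearity_ge1 hF (udom _)).
      apply: (@le_trans _ _ (mu * (k s ^+ 2 * g s ^+ 2) / s ^+ 2 * F (u (g s)))).
        by rewrite ler_wpM2r// gle.
      rewrite [leLHS](_ : _ = (k s ^+ 2 * g s ^+ 2 * (mu * F (u (g s)))) / s ^+ 2); last first.
        by field; rewrite gt_eqF.
      rewrite ler_wpM2r ?invr_ge0 ?exprn_ge0 ?(ltW s0)// lerDr.
      by apply: mulr_ge0; [exact: kdk|apply: mulr_ge0; [exact: sqr_ge0|exact: a0]].
    + exact: flux_cvg0 N0 (cb 0).
    + move=> s s01; have [gs _ _] := gd _ s01; have /andP[s0 s1] := s01.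
      apply: divr_ge0; last exact: sqr_ge0.
      by apply: mulr_ge0; [exact: k0|apply: mulr_ge0; [exact: sqr_ge0|exact: a0]].
    + exact: continuous_subspaceT.
    + by rewrite /= g1 u1 h1.
  split; last by move=> r c [r01 ->]; exact: hu.
  apply: (poisson_le_of_pos hv) => s /hu/le_trans; apply.
  by case/andP: (uM (g s)).
by exists u'.
Qed.

End Comparison.

Section Changes.
Context {R : realType}.
Implicit Types (r p alpha : R) (m : nat).

Lemma power_lt1 p r : 0 < p -> 0 < r < 1 -> 0 < r `^ p < 1.
Proof.
move=> p0 /andP[r0 r1]; rewrite powR_gt0//=.
by have := gt0_ltr_powR p0 => /(_ r 1); rewrite !nnegrE powR1; apply; rewrite ?ltW.
Qed.

(** For g = r ^ p with p = 1 + alpha / 2 the weight becomes exactly r ^ alpha,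
    since p ^ 2 g ^ 2 / r ^ 2 = p ^ 2 r ^ alpha. *)
Lemma power_change p : 0 < p ->
  radial_change (fun r => r `^ p) (fun=> p) (fun=> 0).
Proof.
move=> p0; split=> [r r01|r /andP[r0 _]|]; last by rewrite powR1.
- have /andP[r0 r1] := r01; split; [exact: power_lt1| |exact: is_derive_cst].
  apply: (is_derive_eq (is_derive1_powR p r0)).
  by rewrite -(mulr_powRB1 (ltW r0) p0); field; rewrite gt_eqF.
- exact: is_derive_continuous (is_derive1_powR p r0).
Qed.

Lemma power_square p alpha r : 0 < r -> alpha = 2 * p - 2 ->
  (r `^ p) ^+ 2 = r `^ alpha * r ^+ 2.
Proof.
move=> r0 alphaE.
rewrite -powR_mulrn ?powR_ge0// -powRrM -(powR_mulrn 2 (ltW r0)) -powRD.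
  by congr (_ `^ _); rewrite alphaE; ring.
by apply/implyP => _; rewrite gt_eqF.
Qed.

Lemma power_surj p s : 0 < p -> 0 < s <= 1 -> exists2 r, 0 < r <= 1 & r `^ p = s.
Proof.
move=> p0 /andP[s0 s1]; exists (s `^ p^-1).
  rewrite powR_gt0//=; have pi0 : 0 <= p^-1 by rewrite invr_ge0 ltW.
  by have := ge0_ler_powR pi0 => /(_ s 1); rewrite !nnegrE powR1; apply => //; rewrite ltW.
by rewrite -powRrM mulVf ?gt_eqF// powRr1// ltW.
Qed.

(** In dimension N = m + 2 this satisfies - ln (flat r) = (p / m) (r ^ - m -
    1): up to a factor, the N-dimensional fundamental solution is mapped to the
    logarithm. As a function of s = r ^ p, it tends to s when m / p tends to 0.
    *)
Definition flat m p r := expR (p / m%:R * (1 - (r ^+ m)^-1)).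

Lemma flat_change m p : (0 < m)%N -> 0 < p ->
  radial_change (flat m p) (fun r => p / r ^+ m) (fun r => - (m%:R * p / r ^+ m.+1)).
Proof.
move=> m0 p0; have mpos : 0 < m%:R :> R by rewrite ltr0n.
have dg r : 0 < r -> is_derive r 1 (flat m p) (p / r ^+ m * flat m p r / r).
  move=> r0; have rm : r ^+ m != 0 by rewrite expf_neq0// gt_eqF.
  have d1 : is_derive r 1 (fun=> 1 : R) 0 by exact: is_derive_cst.
  have di := @is_derive_inv _ (fun t => t ^+ m) _ _ rm (is_derive_pow m r).
  have de := is_derive_scale (p / m%:R) (is_deriveB d1 di).
  apply: (is_derive_eq (is_derive1_comp (is_derive_expR _) de)).
  rewrite -/(flat m p r); case: m m0 mpos rm {di de} => // n _ mpos _ /=.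
  rewrite (exprS r n); have : r ^+ n != 0 by rewrite expf_neq0// gt_eqF.
  move: (r ^+ n) (flat n.+1 p r) (n.+1%:R : R) mpos => X E k k0 X0.
  by field; rewrite X0 !gt_eqF.
split=> [r r01|r /andP[r0 _]|].
- have /andP[r0 r1] := r01; have rm : 0 < r ^+ m by rewrite exprn_gt0.
  split; [|exact: dg|].
    rewrite expR_gt0/= expR_lt1 pmulr_rlt0 ?divr_gt0// subr_lt0 invf_gt1//.
    by rewrite exprn_ilt1// ?(ltW r0)// -lt0n.
  have := is_derive_scale p
    (@is_derive_inv _ (fun t => t ^+ m) _ _ (lt0r_neq0 rm) (is_derive_pow m r)).
  move=> dk; apply: (is_derive_eq dk).
  case: m m0 mpos rm {dg dk} => // n _ mpos rm /=.
  by rewrite !exprS; field; rewrite expf_neq0 ?gt_eqF.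
- exact: is_derive_continuous (dg _ r0).
- by rewrite /flat expr1n invr1 subrr mulr0 expR0.
Qed.

Lemma flat_surj m p s : (0 < m)%N -> 0 < p -> 0 < s <= 1 ->
  exists2 r, 0 < r <= 1 & flat m p r = s.
Proof.
move=> m0 p0 /andP[s0 s1]; have mpos : 0 < m%:R :> R by rewrite ltr0n.
have ls : ln s <= 0 by rewrite ln_le0.
pose y := 1 - m%:R / p * ln s.
have y1 : 1 <= y.
  by rewrite /y lerDl oppr_ge0 mulr_ge0_le0// divr_ge0 ?ltW.
have y0 : 0 < y by apply: lt_le_trans y1.
have yi : 0 < y^-1 <= 1 by rewrite invr_gt0 y0 invf_le1.
have /andP[yi0 yi1] := yi.
have [r r01 rE] := power_surj mpos yi.
exists r => //; have /andP[r0 _] := r01.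
move: rE; rewrite powR_mulrn ?(ltW r0)// => rE.
rewrite /flat rE invrK /y opprB addrCA subrr addr0.
have -> : p / m%:R * (m%:R / p * ln s) = ln s by field; rewrite !gt_eqF.
by rewrite lnK.
Qed.

(** After taking logarithms, with e = m / p and y = r ^ - m, the claim is (2 +
    2 / e) ln y <= 2 e + (2 / e) (y - 1). It follows from the tangent line of
    ln at 1 + e, where the difference of the two sides is critical. *)
Lemma flat_weight_le m p alpha r : (0 < m)%N -> 0 < p -> alpha = 2 * p - 2 -> 0 < r < 1 ->
  ((p / r ^+ m) ^+ 2 * flat m p r ^+ 2) / r ^+ 2 <=
    p ^+ 2 * expR (2 * m%:R / p) * r `^ alpha.
Proof.
move=> m0 p0 alphaE /andP[r0 r1].
have mpos : 0 < m%:R :> R by rewrite ltr0n.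
set e := m%:R / p; have e0 : 0 < e by rewrite divr_gt0.
set y := (r ^+ m)^-1; have y0 : 0 < y by rewrite invr_gt0 exprn_gt0.
have lny : ln y = - (m%:R * ln r).
  by rewrite lnV ?posrE ?exprn_gt0// lnXn// mulr_natl.
have main : (2 + 2 / e) * ln y <= 2 * e + 2 / e * (y - 1).
  (* Tangent line at 1 + e, together with ln (1 + e) <= e. *)
  have lny2 : ln y <= y / (1 + e) - 1 + e.
    have -> : ln y = ln (y / (1 + e)) + ln (1 + e).
      by rewrite ln_div ?posrE ?subrK//; lra.
    have l1 : ln (y / (1 + e)) <= y / (1 + e) - 1.
      have := @le_ln1Dx _ (y / (1 + e) - 1); rewrite addrCA subrr addr0; apply.
      by rewrite ltrBDr addNr divr_gt0//; lra.
    have l2 : ln (1 + e) <= e by apply: le_ln1Dx; lra.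
    lra.
  apply: (@le_trans _ _ ((2 + 2 / e) * (y / (1 + e) - 1 + e))).
    by rewrite ler_wpM2l// addr_ge0 ?divr_ge0 ?ltW.
  by rewrite le_eqVlt; apply/orP; left; apply/eqP; field; rewrite !gt_eqF//; lra.
have -> : r `^ alpha = expR (alpha * ln r) by rewrite /powR gt_eqF.
have -> : flat m p r ^+ 2 = expR (2 / e * (1 - y)).
  by rewrite /flat -expRM_natl -/y; congr expR; rewrite /e; field; rewrite !gt_eqF.
have -> : (p / r ^+ m) ^+ 2 * expR (2 / e * (1 - y)) / r ^+ 2 =
    p ^+ 2 * expR (2 / e * (1 - y) + 2 * ln y - 2 * ln r).
  rewrite expRD expRD expRN !expRM_natl !lnK ?posrE// -/y.
  by rewrite /y; field; rewrite expf_neq0 ?gt_eqF.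
rewrite -[leRHS]mulrA -expRD ler_pM2l ?exprn_gt0// ler_expR.
have -> : 2 * m%:R / p = 2 * e by rewrite /e mulrA.
have pE : 2 / e * ln y = - (2 * p * ln r).
  by rewrite lny /e; field; rewrite !gt_eqF.
have : alpha * ln r = 2 * p * ln r - 2 * ln r by rewrite alphaE; ring.
lra.
Qed.

(** The analogue of [flat] in dimension one, where the fundamental solution is
    linear. *)
Lemma exp_change p : 0 < p ->
  radial_change (fun r => expR (- (p * (1 - r)))) (fun r => p * r) (fun=> p).
Proof.
move=> p0.
have dg (r : R) : is_derive r 1 (fun r => expR (- (p * (1 - r)))) (p * expR (- (p * (1 - r)))).
  have d1 : is_derive r 1 (fun=> 1 : R) 0 by exact: is_derive_cst.
  have de := is_deriveN (is_derive_scale p (is_deriveB d1 (is_derive_id r (1:R)))).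
  by apply: (is_derive_eq (is_derive1_comp (is_derive_expR _) de)); rewrite !fctE; ring.
split=> [r /andP[r0 r1]|r _|].
- split.
  + by rewrite expR_gt0/= expR_lt1 oppr_lt0 mulr_gt0// subr_gt0.
  + by apply: (is_derive_eq (dg r)); field; rewrite gt_eqF.
  + by apply: (is_derive_eq (is_derive_scale p (is_derive_id r (1:R)))); rewrite mulr1.
- exact: is_derive_continuous (dg r).
- by rewrite subrr mulr0 oppr0 expR0.
Qed.

(** The same computation as for [flat_weight_le] with e = - 1 / p: the tangent
    line of ln is taken at 1 - 1 / p. *)
Lemma exp_weight_ge p alpha r : 1 < p -> alpha = 2 * p - 2 -> 0 < r < 1 ->
  p ^+ 2 * expR (- (2 / p)) * r `^ alpha <=
    ((p * r) ^+ 2 * expR (- (p * (1 - r))) ^+ 2) / r ^+ 2.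
Proof.
move=> p1 alphaE /andP[r0 r1].
have p0 : 0 < p by lra.
(* Tangent line at 1 - 1 / p, together with ln (1 - 1 / p) <= - 1 / p. *)
have lnr : ln r <= r * p / (p - 1) - 1 - p^-1.
  have -> : ln r = ln (r * p / (p - 1)) + ln (1 - p^-1).
    rewrite -lnM ?posrE; [|by rewrite divr_gt0 ?mulr_gt0//; lra|by rewrite subr_gt0 invf_lt1].
    by congr ln; field; rewrite !gt_eqF//; lra.
  have l1 : ln (r * p / (p - 1)) <= r * p / (p - 1) - 1.
    have := @le_ln1Dx _ (r * p / (p - 1) - 1); rewrite addrCA subrr addr0; apply.
    by rewrite ltrBDr addNr divr_gt0 ?mulr_gt0//; lra.
  have l2 : ln (1 - p^-1) <= - p^-1.
    by apply: le_ln1Dx; rewrite ltrN2 invf_lt1.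
  lra.
have -> : r `^ alpha = expR (alpha * ln r) by rewrite /powR gt_eqF.
rewrite [leRHS](_ : _ = p ^+ 2 * expR (- (2 * (p * (1 - r))))).
  rewrite -[leLHS]mulrA -expRD ler_pM2l ?exprn_gt0//.
  rewrite ler_expR.
  have : alpha * ln r <= alpha * (r * p / (p - 1) - 1 - p^-1) by rewrite ler_pM2l// alphaE; lra.
  have -> : alpha * (r * p / (p - 1) - 1 - p^-1) = 2 / p - 2 * (p * (1 - r)).
    by rewrite alphaE; field; rewrite !gt_eqF//; lra.
  lra.
by rewrite -expRM_natl mulrN; field; rewrite gt_eqF.
Qed.

End Changes.

Section Interval.
Context {R : realType} {aF : \bar R} {F : R -> R} (hF : nonlinearity aF F).
Implicit Types (r p c M alpha lambda mu : R).

(** In dimension one a point is not removable, so that the maximum principle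
    off the origin fails. One uses instead that, F being convex, the even part
    (w(r) + w(- r)) / 2 of a solution is a supersolution, with zero flux at the
    origin, and compares fluxes. *)
Lemma planar_solution_of_interval p alpha lambda (w : 'rV[R]_1 -> R) :
  1 <= p -> alpha = 2 * p - 2 -> 0 <= lambda ->
  classical_solution aF F alpha lambda w ->
  exists u, radial_solution aF F 2 0 (lambda / p ^+ 2) u.
Proof.
move=> p1 alphaE lambda0 wsol; have p0 : 0 < p by lra.
have alpha0 : 0 <= alpha by lra.
have [M [M0 MaF wM]] := classical_solution_bound wsol.
have [[cw [C2w _] wdom weq wbd] _] := wsol.
rewrite /weight_region alpha0 in C2w weq.
set e : 'rV[R]_1 := delta_mx 0 0.
have ne (t : R) : enorm (t *: e) = `|t| by rewrite enormZ enorm_delta mulr1.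
pose f (t : R) := w (t *: e).
pose f1 (t : R) := partial 0 w (t *: e).
pose f2 (t : R) := partial 0 (partial 0 w) (t *: e).
have ball (t : R) : `|t| < 1 -> unit_ball 1 (t *: e) by rewrite /unit_ball/= ne.
have df (t : R) : `|t| < 1 -> is_derive t 1 f (f1 t).
  move=> /ball tB; have [C1w _] := C2w; have [/derivableP] := C1w _ 0 tB.
  rewrite -[X in is_derive X](addr0 (t *: e)) => /is_derive_line.
  rewrite [X in is_derive _ _ X](_ : _ = f) ?addr0//.
  by apply/funext => s; rewrite addr0.
have df1 (t : R) : `|t| < 1 -> is_derive t 1 f1 (f2 t).
  move=> /ball tB; have [_ C1w] := C2w; have [/derivableP] := C1w 0 _ 0 tB.
  rewrite -[X in is_derive X](addr0 (t *: e)) => /is_derive_line.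
  rewrite [X in is_derive _ _ X](_ : _ = f1) ?addr0//.
  by apply/funext => s; rewrite addr0.
have f2E (t : R) : `|t| < 1 -> - f2 t = lambda * `|t| `^ alpha * F (f t).
  by move=> tB; have := weq _ (ball _ tB); rewrite /laplacian big_ord1 ne.
have dN (k : R -> R) (t d : R) : is_derive (- t) 1 k d -> is_derive t 1 (fun s => k (- s)) (- d).
  move=> dk; apply: (is_derive_eq (is_derive1_comp dk (is_deriveN (is_derive_id t (1:R))))).
  by rewrite mulrN1.
pose h r := (f r + f (- r)) / 2.
pose a r := - (f1 r - f1 (- r)) / 2 / r.
pose phi r := lambda * r `^ alpha * ((F (f r) + F (f (- r))) / 2).
have Hh : radial_profile 1 h a phi.
  move=> r /andP[r0 r1]; have nr : `|r| < 1 by rewrite gtr0_norm.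
  have nNr : `|- r| < 1 by rewrite normrN.
  have rn0 : r != 0 by rewrite gt_eqF.
  split.
    rewrite [X in is_derive _ _ X](_ : _ = (fun r => 2^-1 * (f r + f (- r)))).
      apply: (is_derive_eq (is_derive_scale 2^-1 (is_deriveD (df _ nr) (dN _ _ _ (df _ nNr))))).
      by rewrite /a; move: (f1 r) (f1 (- r)) => A B; field.
    by apply/funext => s; rewrite mulrC.
  have E1 := f2E _ nr; have E2 := f2E _ nNr.
  rewrite normrN (gtr0_norm r0) in E1 E2.
  have dinv := @is_derive_inv _ (fun t => t) _ _ rn0 (is_derive_id r (1:R)).
  have d1 := is_derive_scale (- 2^-1) (is_deriveB (df1 _ nr) (dN _ _ _ (df1 _ nNr))).
  rewrite [X in is_derive _ _ X](_ : _ = (fun r => - 2^-1 * (f1 r - f1 (- r)) * r^-1)); last first.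
    by apply/funext => s; rewrite /a !mulNr [2^-1 * _]mulrC.
  apply: (is_derive_eq (is_derive_mul d1 dinv)).
  have -> : phi r = (- f2 r - f2 (- r)) / 2 by rewrite /phi E1 E2; field.
  by rewrite /a !fctE; move: (f1 r) (f1 (- r)) (f2 r) (f2 (- r)) => A B C D; field.
have fM (t : R) : `|t| <= 1 -> 0 <= f t <= M by move=> t1; apply: wM; rewrite ne.
have fdom (t : R) : `|t| <= 1 -> nl_domain aF (f t).
  by move=> /fM/andP[t0 t1]; apply: (nl_domain_le t0 t1).
have Ff1 (t : R) : `|t| <= 1 -> 1 <= F (f t) by move=> /fdom/(nonlinearity_ge1 hF).
have a0 r : 0 < r < 1 -> 0 <= a r.
  have flux := @flux_ge0 _ 1 h a phi isT Hh.
  apply: flux => [s /andP[s0 s1]|d d0].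
    have s1' : `|s| <= 1 by rewrite gtr0_norm// ltW.
    have := Ff1 s s1'; have := Ff1 (- s); rewrite normrN => /(_ s1') ? ?.
    by rewrite mulr_ge0 ?mulr_ge0 ?powR_ge0//; lra.
  have n0 : `|0 : R| < 1 by rewrite normr0.
  have cf1 : {for (0 : R), continuous (fun r => f1 r - f1 (- r))}.
    apply: continuous_at_sub; first exact: is_derive_continuous (df1 _ n0).
    have n0' : `|- 0 : R| < 1 by rewrite oppr0.
    exact: is_derive_continuous (dN _ _ _ (df1 _ n0')).
  have := cvg_at_right_filter cf1; rewrite oppr0 subrr.
  move=> /cvgrPdist_lt/(_ d d0) near_f1; near=> s.
  have s0 : s != 0 by rewrite gt_eqF//; near: s; exact: nbhs_right_gt.
  rewrite expr1 /a mulrC divfK//.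
  have : `|0 - (f1 s - f1 (- s))| < d by near: s.
  by rewrite sub0r normrN ltr_norml => /andP[? ?]; lra.
(* The solution is only continuous relative to the closed ball, so that
   continuity up to r = 1 cannot be deduced from differentiability. *)
have ch : {within `]0, 1], continuous h}.
  have fline (sg : R) : `|sg| = 1 -> {within `]0, 1], continuous (fun t => f (sg * t))}.
    move=> sg1; apply/subspace_continuousP => t; rewrite /= in_itv/= => /andP[t0 t1].
    have inball s : 0 < s <= 1 -> unit_cball 1 ((sg * s) *: e).
      by move=> /andP[s0 s1]; rewrite /unit_cball/= ne normrM sg1 mul1r gtr0_norm.
    have /subspace_continuousP/(_ _ (inball t _)) := cw; rewrite t0 t1 => /(_ isT) wt.
    have lt : (sg * s) *: e @[s --> t] --> (sg * t) *: e.
      apply: cvgZ; last exact: cvg_cst.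
      by apply: cvgM; [exact: cvg_cst|exact: cvg_id].
    move=> A /wt; rewrite !nbhs_simpl/= => /lt; rewrite !nbhs_simpl/=.
    apply: filterS => s sA sD; apply: sA; apply: inball.
    by move: sD; rewrite /= in_itv.
  have := fline 1 (normr1 _); have := fline (-1) (normrN1 _) => cN c1.
  rewrite (_ : h = (fun t => (f (1 * t) + f (-1 * t)) * 2^-1)).
    move=> t; have cD := continuous_at_add (c1 t) (cN t).
    exact: (continuous_at_mul cD (@continuous_at_cst R _ 2^-1 t)).
  by apply/funext => t; rewrite mul1r mulN1r.
pose mu := lambda / p ^+ 2.
have mu0 : 0 <= mu by rewrite divr_ge0// exprn_ge0// ltW.
pose B r c := exists2 s, 0 < s <= 1 & r = s `^ p /\ c = h s.
have [gd cg g1] := power_change p0.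
have [|v k cv vM vB kv|u [usol _ _]] :=
    @fixpoint_below _ _ _ hF 2 0 mu M B isT (lexx 0) mu0 M0 MaF.
- move=> r c [s /andP[s0 s1] [_ ->]].
  have s1' : `|s| <= 1 by rewrite gtr0_norm.
  have := fM s s1'; have := fM (- s); rewrite normrN => /(_ s1') /andP[? _] /andP[? _].
  by rewrite /h; lra.
- have kh s : 0 < s <= 1 -> k (s `^ p) <= h s.
    have [b [Hk cb _ [ck k1 kc]]] := kv.
    have b0 : forall r, 0 < r < 1 -> 0 <= b r.
      apply: (radial_poisson_ge0 _ Hk cb) => // t _; rewrite source_planar mulr_ge0//.
      apply: le_trans (nonlinearity_ge1 hF _); rewrite ?ler01//.
      by have /andP[v0 v1] := vM t; exact: (nl_domain_le v0 v1).
    apply: (profile_comparison (isT : (0 < 1)%N) 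
      (radial_change_profile 1 (power_change p0) Hk) Hh) => //.
    + move=> r r01; have [gr _ _] := gd _ r01; have /andP[r0 r1] := r01.
      rewrite source_planar.
      have r1' : `|r| <= 1 by rewrite gtr0_norm// ltW.
      have Nr1' : `|- r| <= 1 by rewrite normrN.
      have hdom : nl_domain aF (h r).
        have := fM _ r1'; have := fM _ Nr1' => /andP[u0 u1] /andP[u2 u3].
        by apply: (@nl_domain_le _ _ _ M) => //; rewrite /h; lra.
      have Fv : F (v (r `^ p)) <= (F (f r) + F (f (- r))) / 2.
        apply: le_trans (nonlinearity_midpoint hF (fdom _ r1') (fdom _ Nr1')).
        apply: (nonlinearity_le hF) => //; first by case/andP: (vM (r `^ p)).
        by apply: vB; exists r; rewrite ?r0 ?ltW.
      have H0 : 0 <= (r `^ p) ^+ 2 * b (r `^ p) by rewrite mulr_ge0 ?exprn_ge0 ?powR_ge0 ?b0.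
      apply: (@le_trans _ _ (p ^+ 2 * (r `^ p) ^+ 2 * (mu * F (v (r `^ p))) / r ^+ 2)).
        rewrite ler_wpM2r ?invr_ge0 ?exprn_ge0 ?(ltW r0)// gerDr /= mulr0 addr0.
        by rewrite mulr_le0_ge0// mulr_le0_ge0 ?(ltW p0)//; lra.
      rewrite [leLHS](_ : _ = lambda * r `^ alpha * F (v (r `^ p))).
        by rewrite /phi ler_wpM2l// mulr_ge0// powR_ge0.
      rewrite (power_square r0 alphaE).
      by rewrite /mu; field; rewrite !gt_eqF.
    + have c1 : p * b (r `^ p) * r `^ (alpha + 1) @[r --> 0^'+] --> p * b 0 * 0.
        apply: cvgM; last by apply: powR_cvg0; lra.
        apply: cvgM; first exact: cvg_cst.
        by apply: (cvg_comp _ _ (powR_cvg0 p0)); exact: cb.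
      rewrite mulr0 in c1; apply: cvg_trans c1; apply: near_eq_cvg; near=> r.
      have r0 : 0 < r by near: r; exact: nbhs_right_gt.
      rewrite expr1 -powR_mulrn ?powR_ge0// -powRrM.
      have -> : r `^ (p * 2%:R) = r `^ (alpha + 1) * r.
        rewrite -{3}(powRr1 (ltW r0)) -powRD; last by apply/implyP => _; rewrite gt_eqF.
        by congr (_ `^ _); rewrite alphaE; ring.
      by field; rewrite gt_eqF.
    + apply: continuous_in_subspaceT => t; rewrite inE/= in_itv/= => t01.
      by apply: continuous_comp; [exact: cg|exact: ck].
    + by rewrite /= powR1 k1 /h /f !wbd ?ne ?normrN ?normr1// addr0 mul0r.
  split; last by move=> r c [s s01 [-> ->]]; exact: kh.
  apply: (poisson_le_of_pos kv) => s /(power_surj p0)[r r01 <-].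
  apply: le_trans (kh _ r01) _; have /andP[r0 r1] := r01.
  have r1' : `|r| <= 1 by rewrite gtr0_norm.
  have := fM r r1'; have := fM (- r); rewrite normrN => /(_ r1') /andP[_ ?] /andP[_ ?].
  by rewrite /h; lra.
by exists u.
Unshelve. all: by end_near. Qed.

End Interval.

(** * Classical solutions from radial ones *)

Section Classical.
Context {R : realType} {aF : \bar R} {F : R -> R} (hF : nonlinearity aF F).
Implicit Types (r p c M alpha lambda mu : R) (N : nat) (u h a phi : R -> R).

Lemma clamp_enorm_cball N (x : 'rV[R]_N) : enorm x <= 1 -> clamp (enorm x) = enorm x.
Proof. by move=> x1; apply: clamp_id; rewrite enorm_ge0. Qed.

Lemma sup_norm_lt N (w : 'rV[R]_N -> R) M : (M%:E < aF)%E ->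
  (forall x, 0 <= w x <= M) -> (sup_norm (EFin \o w) < aF)%E.
Proof.
move=> MaF wM; apply: le_lt_trans MaF; apply: ge_ereal_sup => _ [x _ <-] /=.
by rewrite lee_fin ger0_norm; case/andP: (wM x).
Qed.

Lemma radial_profile_ext N h a phi h' a' phi' :
  (forall r, 0 < r < 1 -> h r = h' r) -> (forall r, 0 < r < 1 -> a r = a' r) ->
  (forall r, 0 < r < 1 -> phi r = phi' r) ->
  radial_profile N h a phi -> radial_profile N h' a' phi'.
Proof.
move=> hh' aa' pp' H r r01; have [dh da] := H r r01.
have nearr : \near r, 0 < r < 1.
  have : r \in `]0, 1[ by rewrite in_itv.
  by move/near_in_itvoo; apply: filterS => s; rewrite in_itv.
rewrite -aa'// -pp'//; split.
  by apply: near_eq_is_derive dh; apply: filterS nearr => s; exact: hh'.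
by apply: near_eq_is_derive da; apply: filterS nearr => s; exact: aa'.
Qed.

(** The class required of a classical solution depends on the sign of alpha:
    the source is singular at the origin when alpha < 0. *)
Lemma classical_of_profile N alpha lambda (h a phi : R -> R) M :
  (2 <= N)%N \/ 0 <= alpha -> (M%:E < aF)%E ->
  radial_profile N h a phi -> continuous h -> (forall r, 0 <= h r <= M) -> h 1 = 0 ->
  (forall r, 0 < r < 1 -> {for r, continuous phi}) ->
  (0 <= alpha -> [/\ continuous a, continuous phi & phi 0 = N%:R * a 0]) ->
  (forall r, 0 <= r < 1 -> phi r = lambda * r `^ alpha * F (h r)) ->
  classical_solution aF F alpha lambda (fun x : 'rV[R]_N => h (enorm x)).
Proof.
move=> N2 MaF H ch hM h1 cphi reg phiE.
have cphi' (x : 'rV[R]_N) : 0 < enorm x < 1 -> {for x, continuous (phi \o (@enorm R N))}.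
  by move=> x01; apply: continuous_comp; [exact: enorm_continuous|exact: cphi].
split; last exact: (sup_norm_lt MaF (fun x => hM (enorm x))).
split.
- apply: continuous_subspaceT => x; apply: continuous_comp; first exact: enorm_continuous.
  exact: ch.
- rewrite /weight_region; case: ifPn => alpha0; last first.
    split; first exact: (radial_C2_punctured H cphi').1.
    by case: N2 => [N2 N1|/idP]; [rewrite N1 in N2|rewrite (negbTE alpha0)].
  have [ca cphi0 phi0] := reg alpha0.
  have [C2u _] := radial_C2 H cphi' (cvg_at_right_filter (cphi0 0))
    (cvg_at_right_filter (ca 0)) (cvg_at_right_filter (ch 0)) phi0.
  by split => // _; case: C2u.
- move=> x x1; have /andP[h0 hM'] := hM (enorm x).
  by split => //; apply: le_lt_trans MaF; rewrite lee_fin.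
- move=> x; rewrite /weight_region; case: ifPn => alpha0; last first.
    move=> /punctured_ballP /[dup] x01 /andP[x0 x1].
    by rewrite (radial_C2_punctured H cphi').2// phiE// ltW.
  have [ca cphi0 phi0] := reg alpha0.
  have [_ lapu] := radial_C2 H cphi' (cvg_at_right_filter (cphi0 0))
    (cvg_at_right_filter (ca 0)) (cvg_at_right_filter (ch 0)) phi0.
  by move=> x1; rewrite lapu// phiE// enorm_ge0.
- by move=> x ->.
Qed.

Lemma classical_of_radial N alpha lambda u : (0 < N)%N -> 0 <= alpha ->
  radial_solution aF F N alpha lambda u ->
  classical_solution aF F alpha lambda (fun x : 'rV[R]_N => u (enorm x)).
Proof.
move=> N0 alpha0 [[a [H ca a0 [cu u1 uc]]] [M [MaF M0 uM]]].
have udom r : nl_domain aF (u r).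
  by have /andP[u0 uM'] := uM r; split=> //; apply: le_lt_trans MaF; rewrite lee_fin.
have cphi := source_continuous hF (lambda := lambda) alpha0 cu udom.
apply: (@classical_of_profile N alpha lambda u a _ M _ MaF H) => //.
- by right.
- by move=> r _; exact: cphi.
- by move=> _; split=> //; rewrite a0 mulrC divfK// pnatr_eq0 -lt0n.
- by move=> r /andP[r0 r1]; rewrite /source clamp_id// r0 ltW.
Qed.

(** In the disc the change r |-> r ^ p turns planar solutions into exact
    solutions for the weight |x| ^ alpha, for every alpha > -2. *)
Lemma classical_of_planar p alpha mu u : 0 < p -> alpha = 2 * p - 2 ->
  radial_solution aF F 2 0 mu u ->
  classical_solution aF F alpha (p ^+ 2 * mu)
    (fun x : 'rV[R]_2 => u (clamp (enorm x) `^ p)).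
Proof.
move=> p0 alphaE [[a [H ca a0 [cu u1 uc]]] [M [MaF M0 uM]]].
have udom r : nl_domain aF (u r).
  by have /andP[u0 uM'] := uM r; split=> //; apply: le_lt_trans MaF; rewrite lee_fin.
have clamp01 r : 0 < r < 1 -> clamp r = r.
  by move=> /andP[/ltW r0 /ltW r1]; rewrite clamp_id ?r0.
have clamp_ge0 (r : R) : 0 <= clamp r by case/andP: (clamp_bounds r).
have cpow b r : 0 <= b -> {for r, continuous (fun s => clamp s `^ b)}.
  by move=> b0; apply: powR_comp_continuous => //; exact: clamp_continuous.
have cuf r (f : R -> R) : {for r, continuous f} -> {for r, continuous (fun s => F (u (f s)))}.
  move=> cf; apply: (nonlinearity_continuous hF) => //.
  by apply: (continuous_comp cf); exact: cu.
pose phi r := p ^+ 2 * mu * clamp r `^ alpha * F (u (clamp r `^ p)).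
pose b r := p * clamp r `^ alpha * a (clamp r `^ p).
have H' : radial_profile 2 (fun r => u (clamp r `^ p)) b phi.
  apply: radial_profile_ext (radial_change_profile 2 (power_change p0) H).
  - by move=> r r01; rewrite /= clamp01.
  - move=> r r01; have /andP[r0 _] := r01; rewrite /b clamp01// (power_square r0 alphaE).
    by field; rewrite gt_eqF.
  - move=> r r01; have /andP[r0 _] := r01.
    rewrite /phi clamp01// (power_square r0 alphaE) source_planar.
    by field; rewrite gt_eqF.
have cphi r : 0 <= alpha \/ 0 < r < 1 -> {for r, continuous phi}.
  move=> rP; apply: continuous_at_mul; last by apply: cuf; apply: cpow; exact: ltW.
  apply: continuous_at_mul; first exact: continuous_at_cst.
  have [/cpow//|r01] := rP.
  apply: (@continuous_comp _ _ _ (@clamp R) (fun s => s `^ alpha)).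
    exact: clamp_continuous.
  rewrite clamp01//; have /andP[r0 _] := r01.
  exact: is_derive_continuous (is_derive1_powR alpha r0).
apply: (@classical_of_profile 2 alpha _ _ b phi M _ MaF H') => //.
- by left.
- move=> r; apply: (@continuous_comp _ _ _ (fun s => clamp s `^ p) u).
    by apply: cpow; exact: ltW.
  exact: cu.
- by rewrite clamp_id ?lexx ?ler01// powR1.
- by move=> r r01; apply: cphi; right.
- move=> alpha0; split.
  + move=> r; apply: (@continuous_at_mul _ _ (fun s => p * clamp s `^ alpha)
      (fun s => a (clamp s `^ p))).
      by apply: continuous_at_mul; [exact: continuous_at_cst|exact: cpow].
    apply: (@continuous_comp _ _ _ (fun s => clamp s `^ p) a).
      by apply: cpow; exact: ltW.
    exact: ca.
  + by move=> r; apply: cphi; left.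
  + have p00 : (0 : R) `^ p = 0 by rewrite powR0// gt_eqF.
    rewrite /phi /b clamp_id ?lexx ?ler01// p00 a0 source_planar.
    have [alpha00|alpha00] := eqVneq alpha 0; last by rewrite powR0// !(mulr0, mul0r).
    have -> : p = 1 by lra.
    by rewrite alpha00 powRr0; field.
- by move=> r /andP[r0 r1]; rewrite /phi clamp_id// r0 ltW.
Qed.

End Classical.

(** * Comparison of the admissible parameters *)

Section Voltages.
Context {R : realType} {aF : \bar R} {F : R -> R} (hF : nonlinearity aF F).
Implicit Types (r p c M alpha lambda mu nu : R) (N : nat) (u h a phi : R -> R).

Lemma radial_solution_dom N alpha lambda u r :
  radial_solution aF F N alpha lambda u -> nl_domain aF (u r).
Proof.
move=> [_ [M [MaF _ uM]]]; have /andP[u0 u1] := uM r.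
by split=> //; apply: le_lt_trans MaF; rewrite lee_fin.
Qed.

(** A solution for a larger parameter is a supersolution, hence a barrier. *)
Lemma radial_solution_smaller N alpha lambda nu u : (0 < N)%N -> 0 <= alpha ->
  0 <= lambda <= nu -> radial_solution aF F N alpha nu u ->
  exists v, radial_solution aF F N alpha lambda v.
Proof.
move=> N0 alpha0 /andP[lambda0 lambdanu] usol.
have [up [M [MaF M0 uM]]] := usol.
have [|v h cv vM vB hv|v [vsol _ _]] := @fixpoint_below _ _ _ hF N alpha lambda M
    (fun r c => c = u r) N0 alpha0 lambda0 M0 MaF.
- by move=> r c ->; case/andP: (uM r).
- have hu r : h r <= u r.
    apply: (radial_poisson_le N0 hv up) => s _; have /andP[v0 _] := vM s.
    have /andP[-> /= H] := source_le hF alpha lambda0 v0 (vB _ _ erefl)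
      (radial_solution_dom s usol).
    apply: le_trans H _; rewrite /source -!mulrA ler_wpM2r// mulr_ge0 ?powR_ge0//.
    by apply: le_trans (nonlinearity_ge1 hF (radial_solution_dom s usol)).
  split=> [r|r c ->//]; apply: le_trans (hu r) _.
  by case/andP: (uM r).
by exists v.
Qed.

(** All planar solutions serve together as barriers. *)
Lemma least_planar_solution mu u : 0 <= mu -> radial_solution aF F 2 0 mu u ->
  exists v, radial_solution aF F 2 0 mu v /\
    forall v', radial_solution aF F 2 0 mu v' -> forall r, v r <= v' r.
Proof.
move=> mu0 usol; have [up [M [MaF M0 uM]]] := usol.
pose B r c := exists2 v, radial_solution aF F 2 0 mu v & c = v r.
have [|v h cv vM vB hv|v [vsol _ vB]] := @fixpoint_below _ _ _ hF 2 0 mu M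
    B isT (lexx 0) mu0 M0 MaF.
- by move=> r c [v [_ [K [_ _ vK]]] ->]; case/andP: (vK r).
- have hB r c : B r c -> h r <= c.
    move=> [v' v'sol ->]; have [v'p _] := v'sol.
    apply: (radial_poisson_le _ hv v'p) => // s _; have /andP[v0 _] := vM s.
    apply: (source_le hF 0 mu0 v0) (radial_solution_dom s v'sol).
    by apply: vB; exists v'.
  split => // r; apply: le_trans (hB r (u r) _) _; first by exists u.
  by case/andP: (uM r).
by exists v; split => // v' v'sol r; apply: vB; exists v'.
Qed.

Lemma planar_of_disc p alpha lambda (w : 'rV[R]_2 -> R) : 0 < p ->
  alpha = 2 * p - 2 -> 0 <= lambda -> classical_solution aF F alpha lambda w ->
  exists u, radial_solution aF F 2 0 (lambda / p ^+ 2) u /\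
    forall x : 'rV[R]_2, 0 < enorm x <= 1 -> u (enorm x `^ p) <= w x.
Proof.
move=> p0 alphaE lambda0 wsol.
apply: (planar_solution_below hF (leqnn 2) wsol (power_change p0)) => //.
- by move=> s s01; exact: power_surj.
- by rewrite divr_ge0// exprn_ge0// ltW.
- by move=> r _; rewrite subrr mul0r mulr0 addr0.
- move=> r /andP[r0 r1]; rewrite (power_square r0 alphaE).
  by rewrite le_eqVlt; apply/orP; left; apply/eqP; field; rewrite !gt_eqF.
Qed.

(** The set whose supremum is the extremal parameter. *)
Definition voltages N alpha : set R := [set lambda | 0 < lambda /\
  exists u : 'rV[R]_N -> R, classical_solution aF F alpha lambda u].

Lemma planar_voltageP mu : voltages 2 0 mu <->
  0 < mu /\ exists u, radial_solution aF F 2 0 mu u.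
Proof.
split=> -[mu0 [u usol]]; split=> //.
  have E : 0 = 2 * 1 - 2 :> R by ring.
  have [v [vsol _]] := planar_of_disc ltr01 E (ltW mu0) usol.
  by exists v; rewrite expr1n divr1 in vsol.
by exists (fun x => u (enorm x)); exact: (classical_of_radial hF).
Qed.

Lemma planar_voltage_smaller mu nu : 0 < mu <= nu -> voltages 2 0 nu -> voltages 2 0 mu.
Proof.
move=> /andP[mu0 munu] /planar_voltageP[nu0 [u usol]]; apply/planar_voltageP.
split=> //; apply: (radial_solution_smaller _ _ _ usol) => //.
by rewrite (ltW mu0).
Qed.

Lemma disc_voltageP p alpha lambda : 0 < p -> alpha = 2 * p - 2 ->
  voltages 2 alpha lambda <-> voltages 2 0 (lambda / p ^+ 2).
Proof.
move=> p0 alphaE; have p20 : 0 < p ^+ 2 by rewrite exprn_gt0.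
split=> [[lambda0 [w wsol]]|/planar_voltageP[mu0 [u usol]]].
  apply/planar_voltageP; rewrite divr_gt0//; split=> //.
  by have [u [usol _]] := planar_of_disc p0 alphaE (ltW lambda0) wsol; exists u.
split; first by move: mu0; rewrite pmulr_lgt0// invr_gt0.
exists (fun x => u (clamp (enorm x) `^ p)).
have := classical_of_planar hF p0 alphaE usol.
by rewrite mulrC divfK// gt_eqF.
Qed.

(** The exponential factor comes from the change of variables [flat] in
    dimension at least 3; its common form for all N allows a single squeeze. *)
Lemma voltage_upper N p alpha lambda : (0 < N)%N -> 1 <= p -> alpha = 2 * p - 2 ->
  voltages N alpha lambda ->
  voltages 2 0 (lambda / (p ^+ 2 * expR (2 * N%:R / p))).
Proof.
move=> N0 p1 alphaE [lambda0 [w wsol]]; have p0 : 0 < p by lra.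
have p20 : 0 < p ^+ 2 by rewrite exprn_gt0.
have E0 : 0 < expR (2 * N%:R / p) by exact: expR_gt0.
have E1 : 1 <= expR (2 * N%:R / p).
  by rewrite -expR0 ler_expR divr_ge0 ?mulr_ge0// ltW.
have up mu u : lambda / (p ^+ 2 * expR (2 * N%:R / p)) <= mu -> 
    radial_solution aF F 2 0 mu u -> voltages 2 0 (lambda / (p ^+ 2 * expR (2 * N%:R / p))).
  move=> le_mu usol; apply: (@planar_voltage_smaller _ mu).
    by rewrite le_mu andbT divr_gt0// mulr_gt0.
  apply/planar_voltageP; split; last by exists u.
  by apply: lt_le_trans le_mu; rewrite divr_gt0// mulr_gt0.
have [N2|] := leqP 2 N; last first.
  move=> N1; have NE : N = 1%N by apply/eqP; rewrite eqn_leq -ltnS N1.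
  subst N; have [u usol] := planar_solution_of_interval hF p1 alphaE (ltW lambda0) wsol.
  apply: up usol; rewrite ler_pM2l// lef_pV2 ?posrE ?mulr_gt0//.
  by rewrite ler_peMr// ltW.
have [|] := ltnP 2 N => [N3|N2']; last first.
  have NE : N = 2%N by apply/eqP; rewrite eqn_leq N2 N2'.
  subst N; have [u [usol _]] := planar_of_disc p0 alphaE (ltW lambda0) wsol.
  apply: up usol; rewrite ler_pM2l// lef_pV2 ?posrE ?mulr_gt0//.
  by rewrite ler_peMr// ltW.
pose m := (N - 2)%N; have m0 : (0 < m)%N by rewrite subn_gt0.
have NE : N%:R - 2 = m%:R :> R by rewrite natrB.
have Em : 0 < expR (2 * m%:R / p) by exact: expR_gt0.
have [||||u [usol _]] := planar_solution_below hF (mu := lambda / (p ^+ 2 * expR (2 * m%:R / p)))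
   N2 wsol (flat_change m0 p0) _ _ (ltW lambda0).
- by move=> s s01; exact: flat_surj.
- by rewrite divr_ge0 ?mulr_ge0// ltW.
- by move=> r /andP[r0 _]; rewrite NE exprS; field; rewrite expf_neq0 ?gt_eqF.
- move=> r r01; have := flat_weight_le m0 p0 alphaE r01.
  move: (expR _) Em (_ ^+ 2 * _ ^+ 2) => E Epos Y; rewrite -!mulrA ler_pM2l// => YE.
  by rewrite ler_pdivrMl ?mulr_gt0// -!mulrA.
apply: up usol; rewrite ler_pM2l// lef_pV2 ?posrE ?mulr_gt0//.
rewrite ler_pM2l// ler_expR ler_pM2r ?invr_gt0// ler_pM2l// ler_nat.
exact: leq_subr.
Qed.

(** The exponential factor comes from dimension one, where r ^ p yields the
    wrong sign in [radial_solution_of_planar] and [exp_change] has to replace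
    it. *)
Lemma voltage_lower N p alpha mu : (0 < N)%N -> 1 < p -> alpha = 2 * p - 2 ->
  voltages 2 0 mu ->
  voltages N alpha (mu * (p ^+ 2 * expR (- (2 * N%:R / p)))).
Proof.
move=> N0 p1 alphaE /planar_voltageP[mu0 [u usol]]; have p0 : 0 < p by lra.
have alpha0 : 0 <= alpha by lra.
have p20 : 0 < p ^+ 2 by rewrite exprn_gt0.
have E0 : 0 < expR (- (2 * N%:R / p)) by exact: expR_gt0.
have E1 : expR (- (2 * N%:R / p)) <= 1.
  by rewrite -expR0 ler_expR oppr_le0 divr_ge0 ?mulr_ge0// ltW.
have lam0 : 0 < mu * (p ^+ 2 * expR (- (2 * N%:R / p))) by rewrite !mulr_gt0.
suff [v vsol] : exists v,
    radial_solution aF F N alpha (mu * (p ^+ 2 * expR (- (2 * N%:R / p)))) v.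
  by split=> //; exists (fun x => v (enorm x)); exact: (classical_of_radial hF).
have [N2|N1] := leqP 2 N; last first.
  have NE : N = 1%N by apply/eqP; rewrite eqn_leq -ltnS N1.
  subst N; rewrite mulr1 in lam0 *.
  apply: (radial_solution_of_planar hF (isT : (0 < 1)%N) alpha0 (ltW lam0) usol (ltW mu0)
    (exp_change p0)).
  - by move=> r /andP[/ltW r0 _]; rewrite mulr_ge0// ltW.
  - by move=> r _; rewrite le_eqVlt; apply/orP; left; apply/eqP; ring.
  - move=> r r01; have := exp_weight_ge p1 alphaE r01.
    by rewrite -(ler_pM2l mu0) !mulrA.
have [|||v vsol] := radial_solution_of_planar hF N0 alpha0 (lambda := mu * p ^+ 2) _ usol (ltW mu0)
  (power_change p0) (fun r _ => ltW p0).
- by rewrite mulr_ge0// ltW.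
- by move=> r _; rewrite mulr0 addr0 mulr_ge0 ?(ltW p0)// subr_ge0 ler_nat.
- move=> r /andP[r0 r1]; rewrite (power_square r0 alphaE).
  by rewrite le_eqVlt; apply/orP; left; apply/eqP; field; rewrite gt_eqF.
apply: (radial_solution_smaller N0 alpha0 _ vsol).
by rewrite (ltW lam0)/= mulrA ler_piMr// ltW// mulr_gt0.
Qed.

End Voltages.
Arguments voltages {R} aF F N alpha.

(** * The extremal parameter *)

Section ExtremalParameter.
Context {R : realType} {aF : \bar R} {F : R -> R}.
Context (hF : regular_nonlinearity aF F \/ singular_nonlinearity aF F).
Implicit Types (r p c M alpha lambda mu nu : R) (N : nat) (u h a phi : R -> R).

Lemma growing_nonlinearity : nonlinearity aF F.
Proof. by case: hF => -[]. Qed.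

Lemma half_lt_endpoint : ((2^-1 : R)%:E < aF)%E.
Proof. by case: hF => -[_ -> _]; rewrite ?ltry// lte_fin; lra. Qed.

(** In the regular case by superlinearity; in the singular case because F >= 1
    > t. *)
Lemma nonlinearity_linear_growth :
  exists2 d : R, 0 < d & forall t, nl_domain aF t -> d * t <= F t.
Proof.
have hN := growing_nonlinearity.
case: hF => -[_ aFE Flim]; last first.
  exists 1 => // t /[dup] tdom [_]; rewrite aFE lte_fin mul1r => /ltW t1.
  by apply: le_trans t1 _; exact: (nonlinearity_ge1 hN).
move/cvgryPge : Flim => /(_ 1) [A [_ AP]].
pose B := Num.max 1 (A + 1).
have B1 : 1 <= B by rewrite le_max lexx.
have BA : A < B by rewrite lt_max ltrDl ltr01 orbT.
have B0 : 0 < B by apply: lt_le_trans B1.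
exists B^-1; first by rewrite invr_gt0.
move=> t /[dup] tdom [t0 _]; have F1 := nonlinearity_ge1 hN tdom.
have [tB|Bt] := leP t B.
  by apply: le_trans F1; rewrite ler_pdivrMl// mulr1.
have tpos : 0 < t by apply: lt_trans Bt.
have := AP t (lt_trans BA Bt); rewrite ler_pdivlMr// mul1r; apply: le_trans.
by rewrite ler_piMl// invf_le1.
Qed.

(** The constant 1/2 is a barrier for a small parameter: the solution of the
    linear problem with source at most 1/2 is itself at most 1/2. *)
Lemma planar_voltages_nonempty : voltages aF F 2 0 !=set0.
Proof.
have hN := growing_nonlinearity; have haF := half_lt_endpoint.
have hdom : nl_domain aF 2^-1 by split => //; lra.
have F1 := nonlinearity_ge1 hN hdom; have F0 : 0 < F 2^-1 by lra.
pose mu := (2 * F 2^-1)^-1; have mu0 : 0 < mu by rewrite invr_gt0 mulr_gt0.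
exists mu; apply/(planar_voltageP hN); split=> //.
have h0 : 0 <= 2^-1 :> R by lra.
have [|v h cv vM _ hv|u [usol _ _]] := @fixpoint_below _ _ _ hN 2 0 mu 2^-1
    (fun _ _ => False) isT (lexx 0) (ltW mu0) h0 haF _ _; [by []| |by exists u].
split=> // r.
have [a [_ _ _ [_ h1 hc]]] := hv; rewrite -hc.
have := @radial_poisson_lipschitz _ 2 _ _ 2^-1 isT hv _ (clamp r) 1.
have /andP[c0 c1] := clamp_bounds r.
rewrite h1 subr0 => H; apply: le_trans (ler_norm _) _; apply: le_trans (H _) _; last first.
  by rewrite ler0_norm; lra.
move=> s _; have /andP[v0 v1] := vM s.
have /andP[-> /= H'] := @source_le _ _ _ hN 0 mu v (fun=> 2^-1) s (ltW mu0) v0 v1 hdom.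
apply: le_trans H' _; rewrite source_planar /mu le_eqVlt; apply/orP; left; apply/eqP.
by field; rewrite gt_eqF.
Qed.

(** On the disc of radius 1/2 the source is at least K = mu F(u(1/2)), because
    u decreases. The flux through the circle of radius 1/2, and through all
    larger ones, is therefore at least K / 8, and integrating the slope over
    [1/2, 1] gives u(1/2) >= K / 16. *)
Lemma planar_solution_mid_ge mu u : 0 < mu -> radial_solution aF F 2 0 mu u ->
  mu * F (u 2^-1) / 16 <= u 2^-1.
Proof.
move=> mu0 usol; have hN := growing_nonlinearity.
have udom r := radial_solution_dom r usol.
have [[a [H ca _ [cu u1 _]]] _] := usol.
have a0 r : 0 < r < 1 -> 0 <= a r.
  apply: (radial_poisson_ge0 _ H ca) => // t _; rewrite source_planar mulr_ge0 ?(ltW mu0)//.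
  by apply: le_trans (nonlinearity_ge1 hN (udom t)).
set K := mu * F (u 2^-1).
pose J r := r ^+ 2 * a r.
have dJ r : 0 < r < 1 -> is_derive r 1 J (r * (mu * F (u r))).
  move=> r01; apply: (is_derive_eq (@radial_profile_flux _ 2 _ _ _ _ isT H r01)).
  by rewrite expr1 source_planar.
have cJ : continuous J.
  move=> t; apply: (@continuous_at_mul _ _ (fun r => r ^+ 2) a); last exact: ca.
  exact: exprn_continuous.
have u_decr r : 0 < r < 2^-1 -> u 2^-1 <= u r.
  move=> /andP[r0 r1]; rewrite -lerN2.
  apply: (@le_of_derive_ge0 _ (fun t => - u t) (fun t => t * a t)); first exact: ltW.
  - move=> t /andP[rt t1]; have [|dh _] := H t; first by apply/andP; split; lra.
    by apply: (is_derive_eq (is_deriveN dh)); rewrite opprK.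
  - by move=> t /andP[rt t1]; apply: mulr_ge0; [lra|apply: a0; apply/andP; split; lra].
  - by apply: continuous_subspaceT => t; apply: (@continuous_at_opp _ _ u); exact: cu.
have J_half : K / 8 <= J 2^-1.
  have := @le_of_derive_ge0 _ (fun t => J t - K / 2 * t ^+ 2)
    (fun t => t * (mu * F (u t)) - K / 2 * (2%:R * t ^+ 1)) 0 2^-1.
  rewrite /J expr0n /= mul0r mulr0 subr0 => inc.
  suff : 0 <= J 2^-1 - K / 2 * 2^-1 ^+ 2 by rewrite expr2 /J; lra.
  apply: inc; first lra.
  - move=> t /andP[t0 t1]; apply: is_deriveB.
      by apply: dJ; apply/andP; split; lra.
    exact: is_derive_scale (is_derive_pow 2 t).
  - move=> t /andP[t0 t1]; rewrite expr1.
    have : F (u 2^-1) <= F (u t).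
      apply: (nonlinearity_le hN) => //; first by case: (udom 2^-1).
      by apply: u_decr; rewrite t0.
    move=> FF; have -> : t * (mu * F (u t)) - K / 2 * (2%:R * t)
        = t * (mu * (F (u t) - F (u 2^-1))).
      by rewrite /K; field.
    by rewrite !mulr_ge0 ?subr_ge0 ?(ltW t0) ?(ltW mu0).
  - apply: continuous_subspaceT => t.
    apply: (@continuous_at_sub _ _ J (fun r => K / 2 * r ^+ 2)); first exact: cJ.
    apply: (@continuous_at_mul _ _ (fun=> K / 2) (fun r => r ^+ 2)).
      exact: continuous_at_cst.
    exact: exprn_continuous.
have J_ge r : 2^-1 <= r < 1 -> K / 8 <= J r.
  move=> /andP[r0 r1]; apply: le_trans J_half _.
  apply: (@le_of_derive_ge0 _ J (fun t => t * (mu * F (u t)))) => //.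
  - by move=> t /andP[t0 t1]; apply: dJ; apply/andP; split; lra.
  - move=> t /andP[t0 t1]; have := nonlinearity_ge1 hN (udom t) => Ft.
    by apply: mulr_ge0; [lra|apply: mulr_ge0; [exact: ltW|lra]].
  - exact: continuous_subspaceT.
have K0 : 0 <= K.
  by rewrite mulr_ge0 ?(ltW mu0)// (le_trans ler01)// (nonlinearity_ge1 hN).
have := @le_of_derive_ge0 _ (fun t => - u t - K / 8 * t) (fun t => t * a t - K / 8) 2^-1 1.
rewrite u1 => inc; suff : - u 2^-1 - K / 8 * 2^-1 <= - 0 - K / 8 * 1 by lra.
apply: inc; first lra.
- move=> t /andP[t0 t1]; have t01 : 0 < t < 1 by apply/andP; split; lra.
  have [dh _] := H t t01.
  apply: (is_derive_eq (is_deriveB (is_deriveN dh)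
    (is_derive_scale (K / 8) (is_derive_id t (1:R))))).
  by ring.
- move=> t /andP[t0 t1]; have tpos : 0 < t by lra.
  rewrite subr_ge0; have := J_ge t; rewrite (ltW t0) t1 => /(_ isT) JK.
  apply: le_trans JK _; rewrite /J expr2 -mulrA ler_piMl ?(ltW t1)//.
  by rewrite mulr_ge0 ?(ltW tpos)// a0// tpos.
- apply: continuous_subspaceT => t.
  apply: (@continuous_at_sub _ _ (fun t => - u t) (fun t => K / 8 * t)).
    by apply: (@continuous_at_opp _ _ u); exact: cu.
  by apply: (@continuous_at_mul _ _ (fun=> K / 8) id); [exact: continuous_at_cst|exact: cvg_id].
Qed.

(** Combining the midpoint estimate with linear growth of F, the value u(1/2) >
    0 cancels. *)
Lemma planar_voltages_bounded : has_ubound (voltages aF F 2 0).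
Proof.
have hN := growing_nonlinearity; have [d d0 dF] := nonlinearity_linear_growth.
exists (16 / d) => mu /(planar_voltageP hN)[mu0 [u usol]].
have mid := planar_solution_mid_ge mu0 usol.
have udom := radial_solution_dom 2^-1 usol.
have F1 := nonlinearity_ge1 hN udom; have dFu := dF _ udom.
have m0 : 0 < u 2^-1.
  by apply: lt_le_trans mid; rewrite divr_gt0// mulr_gt0//; lra.
rewrite ler_pdivlMr// -(ler_pM2r m0).
have : mu * (d * u 2^-1) <= mu * F (u 2^-1) by rewrite ler_pM2l.
rewrite mulrA; lra.
Qed.

Local Notation Lstar := (extremal_parameter aF F 2 0).

Lemma planar_extremal_gt0 : 0 < Lstar.
Proof.
have [mu muS] := planar_voltages_nonempty.
apply: lt_le_trans (ub_le_sup planar_voltages_bounded muS).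
by case: muS.
Qed.

Lemma sup_le_scale (A B : set R) c : 0 < c -> A !=set0 -> has_ubound B ->
  (forall x, A x -> B (x / c)) -> sup A <= c * sup B.
Proof.
move=> c0 A0 ubB AB; apply: ge_sup => // x Ax.
by rewrite mulrC -ler_pdivrMr//; apply: ub_le_sup => //; exact: AB.
Qed.

Lemma extremal_parameter_bounds N p alpha : (0 < N)%N -> 1 < p -> alpha = 2 * p - 2 ->
  expR (- (2 * N%:R / p)) <= extremal_parameter aF F N alpha / (p ^+ 2 * Lstar)
    <= expR (2 * N%:R / p).
Proof.
move=> N0 p1 alphaE; have hN := growing_nonlinearity; have L0 := planar_extremal_gt0.
have p20 : 0 < p ^+ 2 by rewrite exprn_gt0//; lra.
have [mu muS] := planar_voltages_nonempty.
have E0 : 0 < p ^+ 2 * expR (2 * N%:R / p) by rewrite mulr_gt0// expR_gt0.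
have e0 : 0 < p ^+ 2 * expR (- (2 * N%:R / p)) by rewrite mulr_gt0// expR_gt0.
have ubN : has_ubound (voltages aF F N alpha).
  have [K KP] := planar_voltages_bounded; exists (K * (p ^+ 2 * expR (2 * N%:R / p))) => x xS.
  by rewrite -ler_pdivrMr//; apply: KP; exact: (voltage_upper hN N0 (ltW p1) alphaE xS).
have lowS x : voltages aF F 2 0 x ->
    voltages aF F N alpha (x / (p ^+ 2 * expR (- (2 * N%:R / p)))^-1).
  by rewrite invrK; exact: (voltage_lower hN N0 p1 alphaE).
have low := sup_le_scale _ planar_voltages_nonempty ubN lowS.
have upp : extremal_parameter aF F N alpha <= p ^+ 2 * expR (2 * N%:R / p) * Lstar.
  apply: sup_le_scale => //.
  - by exists (mu / (p ^+ 2 * expR (- (2 * N%:R / p)))^-1); exact: lowS.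
  - exact: planar_voltages_bounded.
  - by move=> x; exact: (voltage_upper hN N0 (ltW p1) alphaE).
have pL0 : 0 < p ^+ 2 * Lstar by exact: mulr_gt0.
apply/andP; split.
  rewrite ler_pdivlMr// mulrCA mulrA.
  by rewrite -ler_pdivlMl//; apply: low; rewrite invr_gt0.
by rewrite ler_pdivrMr// mulrA [expR _ * _]mulrC.
Qed.

Lemma disc_extremal_parameter p alpha : 0 < p -> alpha = 2 * p - 2 ->
  extremal_parameter aF F 2 alpha = p ^+ 2 * Lstar.
Proof.
move=> p0 alphaE; have hN := growing_nonlinearity.
have p20 : 0 < p ^+ 2 by rewrite exprn_gt0.
have toP x : voltages aF F 2 alpha x -> voltages aF F 2 0 (x / p ^+ 2).
  by move/(disc_voltageP hN _ p0 alphaE).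
have fromP x : voltages aF F 2 0 x -> voltages aF F 2 alpha (x / (p ^+ 2)^-1).
  by move=> xS; apply/(disc_voltageP hN _ p0 alphaE); rewrite invrK mulfK ?gt_eqF.
have [mu muS] := planar_voltages_nonempty.
have ubA : has_ubound (voltages aF F 2 alpha).
  have [K KP] := planar_voltages_bounded; exists (K * p ^+ 2) => x xS.
  by rewrite -ler_pdivrMr//; apply: KP; exact: toP.
apply/eqP; rewrite eq_le; apply/andP; split.
  apply: (sup_le_scale p20 _ planar_voltages_bounded toP).
  by exists (mu / (p ^+ 2)^-1); exact: fromP.
rewrite -ler_pdivlMl//; apply: (sup_le_scale _ planar_voltages_nonempty ubA fromP).
by rewrite invr_gt0.
Qed.

End ExtremalParameter.

(** * Extremal solutions in the disc *)

Section ExtremalSolution.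
Context {R : realType} {aF : \bar R} {F : R -> R}.
Context (hF : regular_nonlinearity aF F \/ singular_nonlinearity aF F).
Implicit Types (r p c M alpha lambda mu nu : R) (N : nat) (u h a phi : R -> R).

Lemma least_solution_ex mu : 0 < mu < extremal_parameter aF F 2 0 ->
  exists u, radial_solution aF F 2 0 mu u /\
    forall v, radial_solution aF F 2 0 mu v -> forall r, u r <= v r.
Proof.
have hN := growing_nonlinearity hF.
move=> /andP[mu0 /(sup_gt (planar_voltages_nonempty hF))[nu nuS munu]].
have [|_ [u usol]] := (planar_voltageP hN mu).1 _.
  by apply: (planar_voltage_smaller hN _ nuS); rewrite mu0 ltW.
exact: (least_planar_solution hN (ltW mu0) usol).
Qed.

(** Every classical solution in the disc lies above some radial one by
    [planar_of_disc], hence above the least radial one. *)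
Lemma minimal_solution_disc p alpha mu u (x : 'rV[R]_2) :
  0 < p -> alpha = 2 * p - 2 -> 0 < mu -> radial_solution aF F 2 0 mu u ->
  (forall v, radial_solution aF F 2 0 mu v -> forall r, u r <= v r) ->
  enorm x <= 1 ->
  minimal_solution aF F 2 alpha (p ^+ 2 * mu) x = u (enorm x `^ p).
Proof.
move=> p0 alphaE mu0 usol uleast; have hN := growing_nonlinearity hF.
have p20 : 0 < p ^+ 2 by rewrite exprn_gt0.
have wsol := classical_of_planar hN p0 alphaE usol.
set w := (fun x : 'rV[R]_2 => _) in wsol.
have wE (y : 'rV[R]_2) : enorm y <= 1 -> w y = u (enorm y `^ p).
  by move=> y1; rewrite /w clamp_enorm_cball.
have wmin : is_minimal_solution aF F alpha (p ^+ 2 * mu) w.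
  split=> // v vsol y y1; rewrite wE//.
  have lam0 : 0 <= p ^+ 2 * mu by rewrite ltW// mulr_gt0.
  have [v' [v'sol v'v]] := planar_of_disc hN p0 alphaE lam0 vsol.
  rewrite mulrAC mulfV ?gt_eqF// mul1r in v'sol.
  have off (z : 'rV[R]_2) : 0 < enorm z <= 1 -> u (enorm z `^ p) <= v z.
    by move=> z01; apply: le_trans (v'v z z01); exact: uleast.
  (* The comparison with radial solutions holds off the origin only, and is
     extended by continuity along a ray. *)
  have [y0|y0] := eqVneq y 0; last by apply: off; rewrite enorm_gt0 y0.
  rewrite y0 enorm0 powR0 ?gt_eqF//.
  have [[cv _ _ _ _] _] := vsol.
  set e : 'rV[R]_2 := delta_mx 0 0.
  have ne r : 0 <= r -> enorm (r *: e) = r.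
    by move=> r0; rewrite enormZ enorm_delta mulr1 ger0_norm.
  have ve : v (r *: e) @[r --> 0^'+] --> v 0.
    have /subspace_continuousP/(_ 0) := cv.
    rewrite /unit_cball/= enorm0 => /(_ ler01) cv0.
    have line : r *: e @[r --> (0 : R)] --> (0 : 'rV[R]_2).
      by have := @line_cvg _ _ e 0; under eq_fun do rewrite addr0.
    move=> A /cv0; rewrite !nbhs_simpl/= => /line; rewrite !nbhs_simpl/= => nA.
    near=> r; have r0 : 0 < r by near: r; exact: nbhs_right_gt.
    have : enorm (r *: e) <= 1 by rewrite ne ?ltW//; near: r; exact: nbhs_right_lt.
    by near: r; exact: cvg_within nA.
  have [[_ [_ _ _ [cu _ _]]] _] := usol.
  have ue : u (r `^ p) @[r --> 0^'+] --> u 0.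
    by apply: (cvg_comp _ _ (powR_cvg0 p0)); exact: cu.
  have cvu : v (r *: e) - u (r `^ p) @[r --> 0^'+] --> v 0 - u 0 by apply: cvgB.
  rewrite -subr_ge0.
  rewrite -(cvg_lim _ cvu)//; apply: limr_ge; first by apply/cvg_ex; eexists; exact: cvu.
  near=> r; have r0 : 0 < r by near: r; exact: nbhs_right_gt.
  have r1 : r <= 1 by near: r; exact: nbhs_right_le.
  by rewrite subr_ge0 -{1}(ne r (ltW r0)); apply: off; rewrite ne ?ltW// r0.
move=> x1; rewrite /minimal_solution.
have [msol mleast] : is_minimal_solution aF F alpha (p ^+ 2 * mu)
    (minimal_solution aF F 2 alpha (p ^+ 2 * mu)).
  rewrite /minimal_solution.
  apply: (@xgetPex _ _ [set u | is_minimal_solution aF F alpha (p ^+ 2 * mu) u]).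
  by exists w.
rewrite -wE//; apply/eqP; rewrite eq_le mleast//=.
by have [_ ->] := wmin.
Unshelve. all: by end_near. Qed.

Lemma cvg_at_left_scale c (l : R) : 0 < c -> (c * t) @[t --> l^'-] --> (c * l)^'-.
Proof.
move=> c0 A nA.
suff : nbhs l (fun t : R => t < l -> A (c * t)) by [].
have {}nA : nbhs (c * l) (fun s : R => s < c * l -> A s) by exact: nA.
have cl : c * t @[t --> l] --> c * l by apply: cvgM; [exact: cvg_cst|exact: cvg_id].
have := cl _ nA; rewrite nbhs_simpl/=; apply: filterS => t tA tl; apply: tA.
by rewrite ltr_pM2l.
Qed.

(** An equality of filters, so that the limits along them coincide without any
    discussion of their existence. *)
Lemma lim_at_left_scale (T : topologicalType) (f g : R -> T) c (l : R) : 0 < c ->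
  (\forall t \near l^'-, f (c * t) = g t) -> f @ (c * l)^'- = g @ l^'-.
Proof.
move=> c0 fg; apply/seteqP; split=> A.
  move=> /(cvg_at_left_scale c0); rewrite !nbhs_simpl/= => fA.
  by apply: filterS2 fA fg => t fAt fgt; rewrite /preimage/= -fgt.
rewrite !nbhs_simpl/= => gA.
have ci0 : 0 < c^-1 by rewrite invr_gt0.
have := @cvg_at_left_scale _ (c * l) ci0; rewrite mulKf ?gt_eqF// => cl.
have : l^'- (fun t => A (f (c * t))) by apply: filterS2 gA fg => t gAt fgt; rewrite fgt.
move=> /cl; rewrite nbhs_simpl/=; apply: filterS => t.
by rewrite /preimage/= mulVKf ?gt_eqF.
Qed.

(** Minimal solutions for |x| ^ alpha and for the constant weight correspond
    through |y| = |x| ^ p and mu |-> p ^ 2 mu, for all mu below the extremal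
    parameter; hence so do their limits. *)
Lemma extremal_solution_disc p alpha (x y : 'rV[R]_2) : 0 < p -> alpha = 2 * p - 2 ->
  enorm x <= 1 -> enorm y = enorm x `^ p ->
  extremal_solution aF F 2 alpha x = extremal_solution aF F 2 0 y.
Proof.
move=> p0 alphaE x1 yx; rewrite /extremal_solution (disc_extremal_parameter hF p0 alphaE).
congr (lim _); apply: lim_at_left_scale; first by rewrite exprn_gt0.
have L0 := planar_extremal_gt0 hF.
near=> mu.
have mu0 : 0 < mu by near: mu; exact: nbhs_left_gt.
have muL : mu < extremal_parameter aF F 2 0 by near: mu; exact: nbhs_left_lt.
have [|u [usol uleast]] := @least_solution_ex mu; first by rewrite mu0.
have y1 : enorm y <= 1.
  rewrite yx; have := ge0_ler_powR (ltW p0) => /(_ (enorm x) 1).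
  by rewrite !nnegrE powR1; apply => //; exact: enorm_ge0.
rewrite (minimal_solution_disc p0 alphaE mu0 usol uleast x1).
have E : 0 = 2 * 1 - 2 :> R by ring.
have := minimal_solution_disc ltr01 E mu0 usol uleast y1.
by rewrite expr1n mul1r powRr1 ?enorm_ge0// yx => ->.
Unshelve. all: by end_near. Qed.

Lemma sup_norm_extremal_disc p alpha : 0 < p -> alpha = 2 * p - 2 ->
  sup_norm (extremal_solution aF F 2 alpha) = sup_norm (extremal_solution aF F 2 0).
Proof.
move=> p0 alphaE; rewrite /sup_norm; congr ereal_sup.
set e : 'rV[R]_2 := delta_mx 0 0.
have ne r : 0 <= r -> enorm (r *: e) = r.
  by move=> r0; rewrite enormZ enorm_delta mulr1 ger0_norm.
have lt1 q r : 0 < q -> 0 <= r -> r < 1 -> r `^ q < 1.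
  move=> q0; rewrite le_eqVlt => /predU1P[<- _|r0 r1]; first by rewrite powR0 ?gt_eqF.
  by have /andP[] : 0 < r `^ q < 1 by apply: power_lt1 => //; rewrite r0.
apply/seteqP; split=> _ [x x1 <-].
  exists (enorm x `^ p *: e); first by rewrite /unit_ball/= ne ?powR_ge0// lt1 ?enorm_ge0.
  by rewrite -(@extremal_solution_disc p alpha x) ?ne ?powR_ge0//; exact: ltW.
have xp : (enorm x `^ p^-1) `^ p = enorm x.
  by rewrite -powRrM mulVf ?gt_eqF// powRr1// enorm_ge0.
have y1 : enorm x `^ p^-1 < 1 by rewrite lt1 ?invr_gt0 ?enorm_ge0.
exists (enorm x `^ p^-1 *: e); first by rewrite /unit_ball/= ne ?powR_ge0.
by rewrite (@extremal_solution_disc p alpha _ x) ?ne ?powR_ge0 ?xp// ltW.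
Qed.

Lemma expR_inv_cvg1 (k : R) : expR (k / (1 + alpha / 2)) @[alpha --> +oo] --> (1 : R).
Proof.
suff k0 : k / (1 + alpha / 2) @[alpha --> +oo] --> (0 : R).
  by rewrite -[X in _ --> X]expR0; exact: (cvg_comp _ _ k0 (@continuous_expR R 0)).
apply/cvgr0Pnorm_lt => e e0; near=> alpha.
have alpha0 : 0 < alpha by near: alpha; exact: nbhs_pinfty_gt.
have alpha1 : 2 * `|k| / e < alpha by near: alpha; apply: nbhs_pinfty_gt; exact: num_real.
have p0 : 0 < 1 + alpha / 2 by lra.
rewrite normrM normfV (gtr0_norm p0) ltr_pdivrMr//.
by move: alpha1; rewrite ltr_pdivrMr//; lra.
Unshelve. all: by end_near. Qed.

End ExtremalSolution.

Theorem corollary4p1 (R : realType) (aF : \bar R) (F : R -> R)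
    (hF : regular_nonlinearity aF F \/ singular_nonlinearity aF F) :
  (forall N : nat, (1 <= N)%N ->
     extremal_parameter aF F N alpha /
       ((1 + alpha / 2) ^+ 2 * extremal_parameter aF F 2 0)
       @[alpha --> +oo] --> (1 : R)) /\
  (forall alpha : R, -2 < alpha ->
     extremal_parameter aF F 2 alpha =
       (1 + alpha / 2) ^+ 2 * extremal_parameter aF F 2 0 /\
     sup_norm (extremal_solution aF F 2 alpha) =
       sup_norm (extremal_solution aF F 2 0)).
Proof.
have pE (alpha : R) : alpha = 2 * (1 + alpha / 2) - 2 by field.
split=> [N N0|alpha alpha2].
  apply: (squeeze_cvgr _ (@expR_inv_cvg1 _ (- (2 * N%:R))) (@expR_inv_cvg1 _ (2 * N%:R))).
  near=> alpha.
  have alpha0 : 0 < alpha by near: alpha; exact: nbhs_pinfty_gt.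
  rewrite mulNr; apply: (extremal_parameter_bounds hF N0 _ (pE alpha)); lra.
have p0 : 0 < 1 + alpha / 2 by lra.
split; first exact: disc_extremal_parameter.
exact: (sup_norm_extremal_disc hF p0).
Unshelve. all: by end_near. Qed.
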